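(* Let $\mathcal M=\mathbb R\times\mathcal N$ with structure $(\phi,\xi,\eta,g^L)$ be the Sasakian lift of a Kähler manifold $(\mathcal N,J,g)$ of real dimension $2n$ with Kähler form $\omega=d\tau$. Let $Ric,s$ be the Ricci tensor and scalar curvature of $g$, and $\overline{Ric},\bar s$ those of $g^L$. For all vector fields $X,Y$ on $\mathcal N$, $$\overline{Ric}(X^L,Y^L)=Ric(X,Y)-2g(X,Y),$$ and in particular $$\bar s=s-2n,$$ where functions on $\mathcal N$ on the right-hand sides are pulled back to $\mathcal M$ by the projection $\pi_2:\mathcal M\to\mathcal N$.
   Context: Conventions: $2\,d\theta(X,Y)=X\theta(Y)-Y\theta(X)-\theta([X,Y])$ for a 1-form $\theta$; $R_{XY}Z=\nabla_X\nabla_YZ-\nabla_Y\nabla_XZ-\nabla_{[X,Y]}Z$ and $Ric(Y,Z)=\mathrm{Tr}\{X\mapsto R_{XY}Z\}$. On a Kähler manifold $(\mathcal N,J,g)$ the Kähler form is $\omega(X,Y)=g(X,JY)$; it is assumed that there is a global 1-form $\tau$ with $\omega=d\tau$. Sasakian lift: $\mathcal M=\mathbb R\times\mathcal N$ with projection $\pi_2:\mathcal M\to\mathcal N$ and coordinate $t$ on $\mathbb R$; $\xi=\partial_t$, $\eta=dt+\pi_2^*\tau$. A vector field $X$ on $\mathcal N$ is lifted to $X^L=X-(\tau(X)\circ\pi_2)\,\xi$ on $\mathcal M$. The $(1,1)$-tensor $\phi$ and metric $g^L$ are determined by $\phi X^L=(JX)^L$, $\phi\xi=0$, $g^L=\eta\otimes\eta+\pi_2^*g$.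 *)

(* Defs.v *)
From HB Require Import structures.
From mathcomp Require Import all_boot all_order all_algebra.
From mathcomp Require Import all_classical all_reals all_analysis.
Set Implicit Arguments. Unset Strict Implicit. Unset Printing Implicit Defensive.
Import Order.TTheory GRing.Theory Num.Theory.
Import numFieldNormedType.Exports.
Local Open Scope classical_set_scope.
Local Open Scope ring_scope.

(* Ck k U f : f is of class C^k on the open set U, for V finite dimensional.
   The total derivative of f is C^k iff all its directional derivatives are. *)
Section Smooth.
Variables (R : realType) (V W : normedModType R).
Fixpoint Ck (k : nat) (U : set V) (f : V -> W) : Prop :=
  match k with
  | 0 => forall x, U x -> {for x, continuous f}
  | k'.+1 => (forall x, U x -> differentiable f x) /\
             forall v, Ck k' U (fun x => 'D_v f x)
  end.
Definition smooth_on (U : set V) (f : V -> W) : Prop := forall k, Ck k U f.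
End Smooth.

Lemma differentiable_near (R : realType) (V W : normedModType R) (f g : V -> W) x :
  {near x, f =1 g} -> differentiable f x -> differentiable g x.
Proof.
move=> fg df; pose h : V -> W := g - f.
have hE : h \o shift x = cst (h x) + (\0 : V -> W) +o_ 0 id.
  apply/eqaddoP => e e0 /=.
  have : \forall y \near 0, f (y + x) = g (y + x) by have := fg; rewrite /prop_near1 [X in X -> _](near_shift 0) subr0.
  apply: filterS => y fgy.
  rewrite -![(_ + _ : _ -> _) _]/(_ + _) -![(- _ : _ -> _) _]/(- _) /= /h.
  rewrite -![(_ + _ : _ -> _) _]/(_ + _) -![(- _ : _ -> _) _]/(- _) fgy (nbhs_singleton fg).
  by rewrite !subrr addr0 subrr normr0 mulr_ge0// ltW.
have c0 : continuous (\0 : {linear V -> W}) by exact: cst_continuous.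
have dh : differentiable h x by apply/diff_locallyP; rewrite (diff_unique c0 hE).
have -> : g = f + h by rewrite /h addrC subrK.
exact: differentiableD.
Qed.

Lemma Ck_eq (R : realType) (V W : normedModType R) k (U : set V) (f g : V -> W) :
  open U -> (forall x, U x -> f x = g x) -> Ck k U f -> Ck k U g.
Proof.
move=> oU; elim: k f g => [|k IH] f g fg /=.
  move=> cf x Ux; have fgx : {near x, f =1 g}.
    by near=> y; apply: fg; near: y; exact: open_nbhs_nbhs.
  have := cf x Ux; rewrite /prop_for /continuous_at -fg// => cfx.
  by apply: cvg_trans cfx; exact: near_eq_cvg.
case=> df Cf; have fgn x : U x -> {near x, f =1 g}.
  by move=> Ux; near=> y; apply: fg; near: y; exact: open_nbhs_nbhs.
split.
  by move=> x Ux; exact: (differentiable_near (fgn x Ux) (df x Ux)).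
move=> v; apply: (IH _ _ _ (Cf v)) => x Ux.
by apply: near_eq_derive; exact: fgn.
Unshelve. all: by end_near. Qed.

Lemma differentiable_affcomp (R : realType) (V V' W' W : normedModType R)
  (A : {linear V -> V'}) (B : {linear W' -> W}) (L : {linear V -> W})
  (F : V' -> W') c x : continuous A -> continuous B -> continuous L ->
  differentiable F (A x) ->
  differentiable (fun x => c + L x + B (F (A x))) x /\
  forall v, 'D_v (fun x => c + L x + B (F (A x))) x = L v + B ('D_(A v) F (A x)).
Proof.
move=> cA cB cL dF.
have dA : differentiable A x by exact: linear_differentiable.
have dB : differentiable B (F (A x)) by exact: linear_differentiable.
have dL : differentiable L x by exact: linear_differentiable.
have dFA : differentiable (F \o A) x by exact: differentiable_comp.
have dBFA : differentiable (B \o (F \o A)) x by exact: differentiable_comp.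
have dcL : differentiable (cst c + (L : V -> W)) x by exact: differentiableD.
have dall : differentiable (cst c + (L : V -> W) + (B \o (F \o A))) x by exact: differentiableD.
split; first exact: dall.
move=> v; rewrite -[LHS]/('D_v (cst c + (L : V -> W) + (B \o (F \o A))) x).
rewrite deriveE// diffD//= diffD// diff_cst /= add0r.
rewrite diff_lin// diff_comp//= diff_lin//= diff_comp//= (diff_lin x cA).
by rewrite deriveE.
Qed.

Lemma Ck_affcomp (R : realType) (V V' W' W : normedModType R) k
  (A : {linear V -> V'}) (B : {linear W' -> W}) (L : {linear V -> W}) c
  (U : set V') (F : V' -> W') : continuous A -> continuous B -> continuous L ->
  open U -> Ck k U F -> Ck k (A @^-1` U) (fun x => c + L x + B (F (A x))).
Proof.
move=> cA cB cL oU.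
have oAU : open (A @^-1` U) by apply: open_comp => // ? _; exact: cA.
elim: k F L c cL => [|k IH] F L c cL /=.
  move=> cF x Ux; apply: continuousD.
    by apply: continuousD; [exact: cst_continuous|exact: cL].
  apply: (@continuous_comp _ _ _ (F \o A) B); last exact: cB.
  by apply: continuous_comp; [exact: cA|exact: cF].
case=> dF CF; split.
  by move=> x Ux; have [] := differentiable_affcomp c cA cB cL (dF _ Ux).
move=> v; have c0 : continuous (\0 : {linear V -> W}) by exact: cst_continuous.
have := IH _ (\0 : {linear V -> W}) (L v) c0 (CF (A v)).
apply: Ck_eq => // x Ux; have [_ ->] := differentiable_affcomp c cA cB cL (dF _ Ux).
by rewrite /= addr0.
Qed.

(* cinv c is the inverse of cmap c on cdom c; outside the image of cdom c its
   values are irrelevant. *)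
Record chart (R : realType) (m : nat) (T : Type) := Chart {
  cdom : set T;
  cmap : T -> 'rV[R]_m;
  cinv : 'rV[R]_m -> T }.

Definition is_chart (R : realType) (m : nat) (T : topologicalType)
    (c : chart R m T) : Prop :=
  [/\ open (cdom c) /\ open (cmap c @` cdom c),
      forall p, cdom c p -> cinv c (cmap c p) = p,
      forall p, cdom c p -> {for p, continuous (cmap c)}
    & forall x, (cmap c @` cdom c) x -> {for x, continuous (cinv c)}].

(* chart_at p is a preferred chart of the atlas around p. The tangent space at p
   is identified with 'rV_m through chart_at p: the row vector v stands for the
   velocity at time 0 of s |-> cinv (chart_at p) (cmap (chart_at p) p + s *: v). *)
Record smooth_manifold (R : realType) (m : nat) := SmoothManifold {
  carrier :> topologicalType;
  atlas : set (chart R m carrier);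
  chart_at : carrier -> chart R m carrier;
  carrier_hausdorff : hausdorff_space carrier;
  carrier_second_countable : @second_countable carrier;
  atlas_chart : forall c, atlas c -> is_chart c;
  chart_at_atlas : forall p, atlas (chart_at p);
  chart_at_dom : forall p, cdom (chart_at p) p;
  atlas_compat : forall c c', atlas c -> atlas c' ->
    smooth_on (cmap c @` (cdom c `&` cdom c')) (cmap c' \o cinv c) }.

Arguments atlas {R m} s _.

Section Product.
Variables (R : realType) (m : nat) (N : smooth_manifold R m).

(* The product manifold R x N, with charts id x c and preferred charts id x chart_at p. *)
Definition line_chart (c : chart R m N) : chart R (1 + m) (R * N) :=
  Chart [set x | cdom c x.2]
        (fun x => row_mx (x.1)%:M (cmap c x.2))
        (fun y => (lsubmx y 0 0, cinv c (rsubmx y))).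

Let line_image c (A : set N) :
  cmap (line_chart c) @` [set x | A x.2] = rsubmx @^-1` (cmap c @` A).
Proof.
apply/seteqP; split => [_ [[t p] /= Ap <-]|y /= [p Ap py]].
  by exists p => //; rewrite row_mxKr.
by exists (lsubmx y 0 0, p) => //=; rewrite py -mx11_scalar hsubmxK.
Qed.

Let line_is_chart c : is_chart c -> is_chart (line_chart c).
Proof.
move=> [[od oi] cK cc ci]; split.
- split; first by apply: open_comp => // x _; exact: cvg_snd.
  rewrite (line_image c (cdom c)).
  by apply: open_comp => // y _; exact: continuous_rsubmx.
- by move=> [t p] /= cp; rewrite row_mxKl row_mxKr cK// mxE eqxx.
- move=> [t p] /= cp A [B Bn BA]; have {}Bn := Bn 0.
  pose P := [set s : R | B 0 (lshift m 0) s].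
  have nP : nbhs t P.
    have := Bn (lshift m 0); rewrite row_mxEl mxE eqxx mulr1n. exact.
  pose Q := [set z : 'rV[R]_m | forall j, B 0 (rshift 1 j) (z 0 j)].
  have nQ : nbhs (cmap c p) Q.
    exists (fun _ j => B 0 (rshift 1 j)).
      by move=> i j; rewrite ord1; have := Bn (rshift 1 j); rewrite row_mxEr.
    by move=> z Hz j; exact: Hz.
  exists (P, cmap c @^-1` Q).
    by split => //=; exact: cc.
  move=> [s q] [/= Ps Qq]; apply: BA => i j; rewrite ord1.
  case: (split_ordP j) => k ->; last by rewrite row_mxEr; exact: Qq.
  by rewrite ord1 row_mxEl mxE eqxx mulr1n.
- rewrite (line_image c (cdom c)) => y /= ry.
  have c1 : {for y, continuous (fun y : 'rV[R]_(1 + m) => lsubmx y 0 0)}.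
    apply: (@continuous_comp _ _ _ lsubmx (fun M : 'M[R]_1 => M 0 0)).
      exact: continuous_lsubmx.
    exact: coord_continuous.
  have c2 : {for y, continuous (cinv c \o (rsubmx : 'rV[R]_(1 + m) -> 'rV_m))}.
    apply: (@continuous_comp _ _ _ rsubmx (cinv c)); first exact: continuous_rsubmx.
    exact: ci.
  exact: (cvg_pair c1 c2).
Qed.


Let line_compat c c' : is_chart c -> is_chart c' ->
  smooth_on (cmap c @` (cdom c `&` cdom c')) (cmap c' \o cinv c) ->
  smooth_on (cmap (line_chart c) @` (cdom (line_chart c) `&` cdom (line_chart c')))
    (cmap (line_chart c') \o cinv (line_chart c)).
Proof.
move=> [[od oi] cK cc ci] [[od' _] _ _ _] sc k.
have oU : open (cmap c @` (cdom c `&` cdom c')).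
  have -> : cmap c @` (cdom c `&` cdom c') =
            (cmap c @` cdom c) `&` cinv c @^-1` cdom c'.
    apply/seteqP; split => [_ [p [cp c'p] <-]|_ [[p cp <-]]] /=.
      by split; [exists p|rewrite cK].
    by rewrite cK// => c'p; exists p.
  rewrite openE => x [Ix Ux]; apply: filterI; first exact: open_nbhs_nbhs.
  by apply: (ci x Ix); exact: open_nbhs_nbhs.
rewrite (line_image c (cdom c `&` cdom c')).
pose emb : {linear 'rV[R]_m -> 'rV[R]_(1 + m)} := mulmxr (row_mx 0 1%:M).
pose prL : {linear 'rV[R]_(1 + m) -> 'rV[R]_(1 + m)} :=
  mulmxr (block_mx 1%:M 0 0 0).
have cmul p q (A : 'M[R]_(p, q)) : continuous (mulmxr A : 'rV[R]_p -> 'rV[R]_q).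
  have -> : (mulmxr A : 'rV[R]_p -> 'rV[R]_q) = (fun x => \sum_i x 0 i *: row i A).
    by apply/funext => x; rewrite /= mulmx_sum_row.
  move=> x; apply: differentiable_continuous.
  elim: (index_enum _) => [|i r IH].
    under eq_fun do rewrite big_nil; exact: differentiable_cst.
  under eq_fun do rewrite big_cons.
  apply: (@differentiableD _ _ _ (fun x : 'rV[R]_p => x 0 i *: row i A)) => //.
  by apply: differentiableZl; exact: differentiable_coord.
have -> : cmap (line_chart c') \o cinv (line_chart c) =
    (fun x => 0 + prL x + emb ((cmap c' \o cinv c) (rsubmx x))).
  apply/funext => x; rewrite add0r /= -[in x *m _](hsubmxK x).
  rewrite mul_row_block mul_mx_row !mulmx0 !mulmx1 !addr0 add_row_mx.
  by rewrite -mx11_scalar addr0 add0r.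
apply: (@Ck_affcomp _ _ _ _ _ k rsubmx emb prL) => //.
- exact: continuous_rsubmx.
- exact: cmul.
- exact: cmul.
Qed.

Let R_second_countable : @second_countable R.
Proof.
exists [set `]ratr ab.1, ratr ab.2[%classic | ab in [set: rat * rat]].
  apply: sub_countable (card_image_le _ _) _; exact: countableP.
split; first by move=> _ [ab _ <-]; exact: itv_open.
move=> x A /nbhs_ballP[e /= e0 xA].
have [a /= xa] : exists q : rat, ratr q \in `]x - e, x[.
  by apply: rat_in_itvoo; rewrite ltrBlDr ltrDl.
have [b /= xb] : exists q : rat, ratr q \in `]x, x + e[.
  by apply: rat_in_itvoo; rewrite ltrDl.
exists `]ratr a, ratr b[%classic.
  split; first by exists (a, b).
  by rewrite /= in_itv/= (itvP xa) (itvP xb).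
move=> y; rewrite /= in_itv/= => /andP[ay yb]; apply: xA.
rewrite /ball/= ltr_distlC (le_lt_trans _ ay) ?(itvP xa)//=.
by rewrite (lt_le_trans yb)// (itvP xb).
Qed.

Let prod_second_countable : @second_countable (R * N)%type.
Proof.
have [B cB [Bo Bb]] := R_second_countable.
have [C cC [Co Cb]] := carrier_second_countable N.
exists [set bc.1 `*` bc.2 | bc in B `*` C].
  by apply: sub_countable (card_image_le _ _) _; exact: countableX.
split.
  move=> _ [[b c] /= [Bb' Cc'] <-]; apply: openI.
    by apply: open_comp; [move=> ? _; exact: cvg_fst|exact: Bo].
  by apply: open_comp; [move=> ? _; exact: cvg_snd|exact: Co].
move=> [t p] A [[P Q] /= [Pt Qp] PQA].
have [b [Bb' bt] bP] := Bb t _ Pt.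
have [c [Cc' cp] cQ] := Cb p _ Qp.
exists (b `*` c); first by split => //; exists (b, c).
by move=> [s q] [/= /bP Ps /cQ Qq]; exact: PQA.
Qed.

Let prod_hausdorff : hausdorff_space (R * N)%type.
Proof.
move=> [t p] [s q] cl; congr (_, _).
  apply: Rhausdorff => A B At Bs.
  have [||[a b] [/= Aa Ba]] := cl (fst @^-1` A) (fst @^-1` B); last by exists a.
    exact: cvg_fst At.
  exact: cvg_fst Bs.
apply: (@carrier_hausdorff _ _ N) => A B Ap Bq.
have [||[a b] [/= Ab Bb]] := cl (snd @^-1` A) (snd @^-1` B); last by exists b.
  exact: cvg_snd Ap.
exact: cvg_snd Bq.
Qed.

Definition line_atlas : set (chart R (1 + m) (R * N)) :=
  [set line_chart c | c in atlas N].

Definition line_chart_at (x : R * N) : chart R (1 + m) (R * N) :=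
  line_chart (chart_at x.2).

Let line_atlas_chart c : line_atlas c -> @is_chart R (1 + m) (R * N)%type c.
Proof. by move=> [c' Nc' <-]; exact/line_is_chart/atlas_chart. Qed.

Let line_chart_at_atlas x : line_atlas (line_chart_at x).
Proof. by exists (chart_at x.2) => //; exact: chart_at_atlas. Qed.

Let line_chart_at_dom x : cdom (line_chart_at x) x.
Proof. exact: chart_at_dom. Qed.

Let line_atlas_compat c c' : line_atlas c -> line_atlas c' ->
  smooth_on (cmap c @` (cdom c `&` cdom c')) (cmap c' \o cinv c).
Proof.
move=> [d Nd <-] [d' Nd' <-].
by apply: line_compat; [exact: atlas_chart|exact: atlas_chart|exact: atlas_compat].
Qed.

Definition line_product : smooth_manifold R (1 + m) :=
  @SmoothManifold R (1 + m) (R * N)%type line_atlas line_chart_at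
    prod_hausdorff prod_second_countable
    line_atlas_chart line_chart_at_atlas line_chart_at_dom line_atlas_compat.

End Product.

Section Fields.
Variables (R : realType) (m : nat) (N : smooth_manifold R m).
Implicit Types (U : set N) (p : N).

Definition smooth_fun U (W : normedModType R) (f : N -> W) : Prop :=
  forall c, atlas N c -> smooth_on (cmap c @` (cdom c `&` U)) (f \o cinv c).

(* X p is the vector of T_p N expressed in the preferred chart at p. *)
Definition vector_field := N -> 'rV[R]_m.

(* The derivative X(f), for f with values in a normed module. *)
Definition vderiv (W : normedModType R) (X : vector_field) (f : N -> W) : N -> W :=
  fun p => 'D_(X p) (f \o cinv (chart_at p)) (cmap (chart_at p) p).

(* X(c) is the row of the components of X in the chart c. *)
Definition smooth_field U (X : vector_field) : Prop :=
  forall c, atlas N c -> smooth_fun (U `&` cdom c) (vderiv X (cmap c)).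

(* The i-th component of [X, Y] is X(Y(x_i)) - Y(X(x_i)), x_i the coordinates at p. *)
Definition lie_bracket (X Y : vector_field) : vector_field := fun p =>
  vderiv X (vderiv Y (cmap (chart_at p))) p -
  vderiv Y (vderiv X (cmap (chart_at p))) p.

Definition vscale (f : N -> R) (X : vector_field) : vector_field := fun p => f p *: X p.

(* Pointwise, in the basis of T_p N given by the preferred chart at p: a one-form
   is a column acting on rows X p by X p *m a p, an endomorphism acts by
   X p *m A p, and a covariant 2-tensor is the matrix of a bilinear form. *)
Definition one_form := N -> 'cV[R]_m.
Definition endomorphism := N -> 'M[R]_m.
Definition two_tensor := N -> 'M[R]_m.

Definition app1 (a : one_form) (X : vector_field) : N -> R :=
  fun p => (X p *m a p) 0 0.
Definition appE (A : endomorphism) (X : vector_field) : vector_field :=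
  fun p => X p *m A p.
Definition app2 (b : two_tensor) (X Y : vector_field) : N -> R :=
  fun p => (X p *m b p *m (Y p)^T) 0 0.

Definition smooth_one_form (a : one_form) : Prop := forall U X,
  open U -> smooth_field U X -> smooth_fun U (app1 a X).
Definition smooth_endomorphism (A : endomorphism) : Prop := forall U X,
  open U -> smooth_field U X -> smooth_field U (appE A X).
Definition smooth_two_tensor (b : two_tensor) : Prop := forall U X Y,
  open U -> smooth_field U X -> smooth_field U Y -> smooth_fun U (app2 b X Y).

(* Normalised by 2 d a(X, Y) = X(a(Y)) - Y(a(X)) - a([X, Y]). *)
Definition ext_deriv (a : one_form) (X Y : vector_field) : N -> R := fun p =>
  2^-1 * (vderiv X (app1 a Y) p - vderiv Y (app1 a X) p - app1 a (lie_bracket X Y) p).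

Definition riemannian_metric (g : two_tensor) : Prop :=
  [/\ smooth_two_tensor g,
      forall p, (g p)^T = g p
    & forall p (v : 'rV[R]_m), v != 0 -> 0 < (v *m g p *m v^T) 0 0].

(* A connection acts on vector fields defined on any open set U (represented by
   total functions that are smooth on U); its axioms are required on each U, and
   its values at arguments that are not smooth near p are irrelevant. *)
Definition connection := vector_field -> vector_field -> vector_field.

Definition affine_connection (D : connection) : Prop :=
  forall U, open U -> forall (X X' Y Y' : vector_field) (f : N -> R),
  smooth_field U X -> smooth_field U X' ->
  smooth_field U Y -> smooth_field U Y' -> smooth_fun U f ->
  smooth_field U (D X Y) /\
  forall p, U p ->
  [/\ D (X \+ X') Y p = D X Y p + D X' Y p,
      D (vscale f X) Y p = f p *: D X Y p,
      D X (Y \+ Y') p = D X Y p + D X Y' p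
    & D X (vscale f Y) p = vderiv X f p *: Y p + f p *: D X Y p].

Definition torsion_free (D : connection) : Prop :=
  forall U, open U -> forall X Y, smooth_field U X -> smooth_field U Y ->
  forall p, U p -> D X Y p - D Y X p = lie_bracket X Y p.

Definition metric_connection (g : two_tensor) (D : connection) : Prop :=
  forall U, open U -> forall X Y Z,
  smooth_field U X -> smooth_field U Y -> smooth_field U Z ->
  forall p, U p ->
  vderiv X (app2 g Y Z) p = app2 g (D X Y) Z p + app2 g Y (D X Z) p.

Definition levi_civita (g : two_tensor) (D : connection) : Prop :=
  [/\ affine_connection D, torsion_free D & metric_connection g D].

Definition curvature (D : connection) (X Y Z : vector_field) : vector_field := fun p =>
  D X (D Y Z) p - D Y (D X Z) p - D (lie_bracket X Y) Z p.

(* The vector field with constant components v in the chart chart_at p, smooth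
   on the domain of that chart: the local extension of v in T_p N. *)
Definition coord_field p (v : 'rV[R]_m) : vector_field := fun q =>
  'D_v (cmap (chart_at q) \o cinv (chart_at p)) (cmap (chart_at p) q).

Lemma coord_fieldE p v : coord_field p v p = v.
Proof.
have [[od oi] cK _ _] := atlas_chart (chart_at_atlas p).
rewrite /coord_field -[RHS](@derive_id R _ (cmap (chart_at p) p)).
apply: near_eq_derive; near=> x.
have [q cq <- /=] : (cmap (chart_at p) @` cdom (chart_at p)) x.
  near: x; apply: open_nbhs_nbhs; split => //.
  by exists p => //; exact: chart_at_dom.
by rewrite cK.
Unshelve. all: by end_near. Qed.

(* Ric(Y, Z) = Tr (X |-> R_{XY} Z), the trace being that of an endomorphism of T_p N. *)
Definition ricci (D : connection) (Y Z : vector_field) : N -> R := fun p =>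
  \tr (lin1_mx (fun v => curvature D (coord_field p v) Y Z p)).

(* The trace of Ric with respect to g, i.e. the sum of g^{ij} Ric_{ij}. *)
Definition scalar_curvature (g : two_tensor) (D : connection) : N -> R :=
  fun p => \tr (invmx (g p) *m \matrix_(i, j)
    ricci D (coord_field p (delta_mx 0 i)) (coord_field p (delta_mx 0 j)) p).

(* An almost Hermitian structure with J parallel for the Levi-Civita connection D. *)
Definition kahler (J : endomorphism) (g : two_tensor) (D : connection) : Prop :=
  [/\ riemannian_metric g,
      levi_civita g D,
      smooth_endomorphism J /\ (forall p, J p *m J p = - 1%:M),
      forall X Y p, app2 g (appE J X) (appE J Y) p = app2 g X Y p
    & forall U, open U -> forall X Y, smooth_field U X -> smooth_field U Y ->
      forall p, U p -> D X (appE J Y) p = appE J (D X Y) p].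

Definition kahler_form (J : endomorphism) (g : two_tensor) (X Y : vector_field) : N -> R :=
  app2 g X (appE J Y).

End Fields.

Record contact_metric (R : realType) (m : nat) (M : smooth_manifold R m) :=
  ContactMetric {
    cm_phi : endomorphism M;
    cm_xi : vector_field M;
    cm_eta : one_form M;
    cm_metric : two_tensor M }.

(* With the preferred charts of R x N, T_(t,p) (R x N) is 'rV_(1 + m), whose first
   entry is the d/dt component and whose last m entries are the component in
   T_p N; the differential of the projection to N is rsubmx. *)
Section Sasakian.
Variables (R : realType) (m : nat) (N : smooth_manifold R m).
Local Notation M := (line_product N).

(* X^L = X - tau(X) d/dt *)
Definition horizontal_lift (tau : one_form N) (X : vector_field N) : vector_field M :=
  fun x => row_mx (- app1 tau X x.2)%:M (X x.2).

(* phi(a, v) = (- tau(J v), J v), xi = d/dt, eta = dt + pi^* tau and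
   g^L = eta (x) eta + pi^* g, pi the projection to N. *)
Definition sasakian_lift (J : endomorphism N) (g : two_tensor N)
    (tau : one_form N) : contact_metric M :=
  let eta (x : M) := col_mx 1%:M (tau x.2) in
  {| cm_phi := fun x : M => block_mx 0 0 (- (J x.2 *m tau x.2)) (J x.2);
     cm_xi := fun=> row_mx 1%:M 0;
     cm_eta := eta;
     cm_metric := fun x : M => eta x *m (eta x)^T + block_mx 0 0 0 (g x.2) |}.

Lemma sasakian_phi_lift J g tau X :
  appE (cm_phi (sasakian_lift J g tau)) (horizontal_lift tau X) = horizontal_lift tau (appE J X).
Proof.
apply/funext => x; rewrite /appE /horizontal_lift /app1 /= mul_row_block !mulmx0 !add0r.
by rewrite mulmxN mulmxA raddfN /= -mx11_scalar.
Qed.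

Lemma sasakian_phi_xi J g tau :
  appE (cm_phi (sasakian_lift J g tau)) (cm_xi (sasakian_lift J g tau)) = fun=> 0.
Proof.
by apply/funext => x; rewrite /appE /= mul_row_block !mulmx0 !mul0mx !add0r row_mx0.
Qed.

Lemma sasakian_eta_xi J g tau x :
  app1 (cm_eta (sasakian_lift J g tau)) (cm_xi (sasakian_lift J g tau)) x = 1.
Proof. by rewrite /app1 /= mul_row_col mulmx1 mul0mx addr0 mxE eqxx. Qed.

Lemma sasakian_eta_lift J g tau X x :
  app1 (cm_eta (sasakian_lift J g tau)) (horizontal_lift tau X) x = 0.
Proof.
rewrite /app1 /= mul_row_col mulmx1 mxE [X in X + _]mxE eqxx mulr1n.
by rewrite /app1 addNr.
Qed.

Lemma sasakian_metric_lift J g tau X Y x :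
  app2 (cm_metric (sasakian_lift J g tau)) (horizontal_lift tau X)
    (horizontal_lift tau Y) x = app2 g X Y x.2.
Proof.
have := sasakian_eta_lift J g tau X x; rewrite /app1 /= => eX.
rewrite /app2 /= mulmxDr mulmxDl mulmxA [X in X + _](_ : _ = 0) ?add0r.
  by rewrite mul_row_block !mulmx0 !add0r tr_row_mx mul_row_col mul0mx add0r.
by rewrite [X in X *m _ *m _](_ : _ = 0) ?mul0mx//; apply/matrixP => i j; rewrite !ord1 eX mxE.
Qed.

End Sasakian.

(* Main.v *)
(* All fields on R x N that occur have the form X^L + f xi with X a field and f a
   function on N, and this class is closed under every operation involved:
   - [X^L + f xi, Y^L + h xi] = [X, Y]^L + (X h - Y f - 2 omega(X, Y)) xi;
   - by the Koszul formula, the Levi-Civita derivative of Y^L + h xi along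
     X^L + f xi is (D_X Y - h JX - f JY)^L + (X h - omega(X, Y)) xi;
   - d/dt is xi, and the coordinate field e_i is e_i^L + tau(e_i) xi.
   Hence the curvature of R x N is computed on N; tracing it and using tr J = 0
   gives, for the Ricci tensor of g^L in dimension 1 + m,
     Ric^L(Y^L + h xi, Z^L + k xi) = Ric(Y, Z) - 2 g(Y, Z) + m h k,
   that is Ric^L = m g^L + pi^*(Ric - (2 + m) g), whose g^L-trace is s - m. *)
Require Import Defs.
From HB Require Import structures.
From mathcomp Require Import all_boot all_order all_algebra.
From mathcomp Require Import all_classical all_reals all_analysis.
From mathcomp Require Import ring.
Set Implicit Arguments. Unset Strict Implicit. Unset Printing Implicit Defensive.
Import Order.TTheory GRing.Theory Num.Theory.
Import numFieldNormedType.Exports.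
Local Open Scope classical_set_scope.
Local Open Scope ring_scope.

(** * Calculus of C^k maps *)

Section CkCalculus.
Variable R : realType.
Implicit Types V W : normedModType R.

(** Two features of the encoding shape the proof. Connections act on total functions and are
    constrained only where the arguments are smooth, while the coordinate fields behind [ricci] and
    [scalar_curvature] are smooth on one chart domain only. Identities are therefore proved over an
    open set U of N and the cylinder above it, and equality on U is carried through [DL] by
    locality. Moreover the preferred chart may jump from point to point, so smoothness has to be
    checked in a fixed chart.

    The trace defining Ric is taken in the coordinate basis d/dt, e_j rather than in an orthonormal
    frame. The contribution of e_j reads only the horizontal part of the curvature, so the vertical
    part is wanted for R_{xi Y} Z alone. In this trace the curvature terms -omega(X, Z) JY and -2
    omega(X, Y) JZ contribute -g(Y, Z) and -2 g(Y, Z), and the direction xi contributes +g(Y, Z):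
    hence the -2 g. The summand m h k is the trace of h k times the identity of the tangent space of
    N. *)

Lemma differentiable_scale V W (f : V -> R) (g : V -> W) x :
  differentiable f x -> differentiable g x ->
  differentiable (fun y => f y *: g y) x /\
  forall v, 'D_v (fun y => f y *: g y) x = f x *: 'D_v g x + 'D_v f x *: g x.
Proof.
(* Scalar multiplication is packaged as a bilinear map, so that the product rule becomes the chain
   rule for its composite with (f, g). *)
move=> df dg; pose S (a : R) (w : W) := a *: w.
have Sb : bilinear_for (GRing.Scale.Law.clone _ _ *:%R _)
    (GRing.Scale.Law.clone _ _ *:%R _) S.
  split=> [u'|u] a x' y' /=; rewrite /S.
    by rewrite scalerDl scalerA.
  by rewrite scalerDr !scalerA mulrC.
pose SM := bilinear_isBilinear.Build R _ _ _ _ _ S Sb.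
pose SB : {bilinear R -> W -> W} := HB.pack S SM.
have Sc : continuous (fun p : R * W => SB p.1 p.2) by move=> p; exact: scale_continuous.
have dS p := differentiable_bilin p Sc.
have dp := differentiable_pair df dg.
have dall : differentiable ((fun p => SB p.1 p.2) \o (fun y => (f y, g y))) x.
  exact: differentiable_comp.
split; first exact: dall.
move=> v; rewrite -[LHS]/('D_v ((fun p => SB p.1 p.2) \o (fun y => (f y, g y))) x).
by rewrite deriveE// diff_comp// diff_bilin// diff_pair//= /S !deriveE.
Qed.

Lemma derive_dirD V W (f : V -> W) x u v : differentiable f x ->
  'D_(u + v) f x = 'D_u f x + 'D_v f x.
Proof. by move=> df; rewrite !deriveE// linearD. Qed.

Lemma derive_dirZ V W (f : V -> W) x a v : differentiable f x ->
  'D_(a *: v) f x = a *: 'D_v f x.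
Proof. by move=> df; rewrite !deriveE// linearZ. Qed.

Lemma derive_comp V V' W (F : V' -> W) (G : V -> V') x v :
  differentiable G x -> differentiable F (G x) ->
  'D_v (F \o G) x = 'D_('D_v G x) F (G x).
Proof.
move=> dG dF; have dFG : differentiable (F \o G) x by exact: differentiable_comp.
by rewrite !deriveE// diff_comp.
Qed.

Lemma derive_row m W (F : 'rV[R]_m -> W) x (v : 'rV[R]_m) : differentiable F x ->
  'D_v F x = \sum_i v 0 i *: 'D_(delta_mx 0 i) F x.
Proof.
move=> dF; rewrite deriveE// [in LHS](row_sum_delta v) linear_sum.
by apply: eq_bigr => i _; rewrite linearZ deriveE.
Qed.

Lemma continuous_mulmxr p q (A : 'M[R]_(p, q)) :
  continuous (mulmxr A : 'rV[R]_p -> 'rV[R]_q).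
Proof.
have -> : (mulmxr A : 'rV[R]_p -> 'rV[R]_q) = (fun x => \sum_i x 0 i *: row i A).
  by apply/funext => x; rewrite /= mulmx_sum_row.
move=> x; apply: differentiable_continuous.
elim: (index_enum _) => [|i r IH].
  under eq_fun do rewrite big_nil; exact: differentiable_cst.
under eq_fun do rewrite big_cons.
apply: (@differentiableD _ _ _ (fun x : 'rV[R]_p => x 0 i *: row i A)) => //.
by apply: differentiableZl; exact: differentiable_coord.
Qed.

Lemma Ck_sub V W k (U U' : set V) (f : V -> W) :
  U' `<=` U -> Ck k U f -> Ck k U' f.
Proof.
move=> UU; elim: k f => [|k IH] f /=; first by move=> cf x /UU; exact: cf.
by case=> df Cf; split=> [x /UU|v]; [exact: df|exact: IH].
Qed.

Lemma CkW V W k (U : set V) (f : V -> W) : Ck k.+1 U f -> Ck k U f.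
Proof.
elim: k f => [|k IH] f [df Cf]; last by split=> // v; exact: IH.
by move=> x Ux; exact/differentiable_continuous/df.
Qed.

Lemma Ck_cst V W k (U : set V) (w : W) : Ck k U (fun=> w).
Proof.
elim: k w => [|k IH] w /=; first by move=> x _; exact: cst_continuous.
split=> [x _|v]; first exact: differentiable_cst.
have -> : (fun x : V => 'D_v (fun=> w) x) = (fun=> 0).
  by apply/funext => x; exact: derive_cst.
exact: IH.
Qed.

Lemma CkD V W k (U : set V) (f g : V -> W) : open U ->
  Ck k U f -> Ck k U g -> Ck k U (fun x => f x + g x).
Proof.
move=> oU; elim: k f g => [|k IH] f g.
  by move=> cf cg x Ux; apply: continuousD; [exact: cf|exact: cg].
move=> [df Cf] [dg Cg]; split=> [x Ux|v].
  exact: differentiableD (df _ Ux) (dg _ Ux).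
apply: Ck_eq (IH _ _ (Cf v) (Cg v)) => // x Ux.
by rewrite [RHS]deriveD//; apply: diff_derivable; [exact: df|exact: dg].
Qed.

Lemma CkZ V W k (U : set V) (f : V -> R) (g : V -> W) : open U ->
  Ck k U f -> Ck k U g -> Ck k U (fun x => f x *: g x).
Proof.
move=> oU; elim: k f g => [|k IH] f g.
  by move=> cf cg x Ux; exact: cvgZ (cf x Ux) (cg x Ux).
move=> Cf' Cg'; have [[df Cf] [dg Cg]] := (Cf', Cg'); split=> [x Ux|v].
  by have [] := differentiable_scale (df _ Ux) (dg _ Ux).
apply: (@Ck_eq _ _ _ _ _ (fun x => f x *: 'D_v g x + 'D_v f x *: g x)) => //.
  by move=> x Ux; have [_ ->] := differentiable_scale (df _ Ux) (dg _ Ux).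
by apply: CkD => //; apply: IH; do ?exact: CkW; [exact: Cg|exact: Cf].
Qed.

Lemma Ck_sum V W k (U : set V) (I : Type) (r : seq I) (f : I -> V -> W) : open U ->
  (forall i, Ck k U (f i)) -> Ck k U (fun x => \sum_(i <- r) f i x).
Proof.
move=> oU Cf; elim: r => [|i r IH].
  by under eq_fun do rewrite big_nil; exact: Ck_cst.
by under eq_fun do rewrite big_cons; exact: CkD.
Qed.

Lemma Ck_linear V W W' k (U : set V) (f : V -> W) (B : {linear W -> W'}) :
  open U -> continuous B -> Ck k U f -> Ck k U (fun x => B (f x)).
Proof.
move=> oU cB Cf.
have c0 : continuous (\0 : {linear V -> W'}) by exact: cst_continuous.
have cid : continuous (idfun : {linear V -> V}) by move=> x; exact: cvg_id.
have := Ck_affcomp 0 cid cB c0 oU Cf.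
by apply: Ck_eq => // x _ /=; rewrite !add0r.
Qed.

Lemma Ck_coord V m k (U : set V) (f : V -> 'rV[R]_m) i : open U ->
  Ck k U f -> Ck k U (fun x => f x 0 i).
Proof.
have clin : linear (fun x : 'rV[R]_m => x 0 i : R) by move=> a x y; rewrite !mxE.
pose cM := GRing.isLinear.Build _ _ _ _ _ clin.
pose cL : {linear 'rV[R]_m -> R} := HB.pack (fun x : 'rV[R]_m => x 0 i : R) cM.
move=> oU Cf; apply: (Ck_linear (B := cL)) oU _ Cf; exact: coord_continuous.
Qed.

(** By the chain rule the derivative of F along ['D_v G x] appears, a direction that varies with x.
    Expanding it in the standard basis leaves products of coordinates of ['D_v G] with
    fixed-direction derivatives of F composed with G, to which the induction applies. *)
Lemma Ck_comp V m W k (U : set V) (U' : set 'rV[R]_m) (F : 'rV[R]_m -> W)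
    (G : V -> 'rV[R]_m) : open U -> open U' -> (forall x, U x -> U' (G x)) ->
  Ck k U' F -> Ck k U G -> Ck k U (F \o G).
Proof.
move=> oU oU' UU'; elim: k F G UU' => [|k IH] F G UU'.
  move=> cF cG x Ux; apply: continuous_comp; first exact: cG.
  by apply: cF; exact: UU'.
move=> CF' CG'; have [[dF CF] [dG CG]] := (CF', CG'); split=> [x Ux|v].
  exact: differentiable_comp (dG _ Ux) (dF _ (UU' _ Ux)).
apply: (@Ck_eq _ _ _ _ _
  (fun x => \sum_i ('D_v G x) 0 i *: ('D_(delta_mx 0 i) F \o G) x)) => //.
  move=> x Ux; have dFx := dF _ (UU' _ Ux).
  by rewrite (derive_comp _ (dG _ Ux) dFx) derive_row.
apply: Ck_sum => // i; apply: CkZ => //; last by apply: IH => //; [exact: CF|exact: CkW].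
exact: Ck_coord i oU (CG v).
Qed.

End CkCalculus.

(** * Smooth functions and fields on a manifold *)

Section ManifoldCalculus.
Variables (R : realType) (m : nat) (N : smooth_manifold R m).
Implicit Types (U V : set N) (p q : N) (W : normedModType R) (c : chart R m N)
  (X Y : vector_field N).

Lemma open_cdom c : atlas N c -> open (cdom c).
Proof. by case/atlas_chart => -[]. Qed.

Lemma cmapK c p : atlas N c -> cdom c p -> cinv c (cmap c p) = p.
Proof. by case/atlas_chart => _ + _ _; exact. Qed.

Lemma open_chart_image c U : atlas N c -> open U -> open (cmap c @` (cdom c `&` U)).
Proof.
case/atlas_chart => [[od oi] cK cc ci] oU.
have -> : cmap c @` (cdom c `&` U) = (cmap c @` cdom c) `&` cinv c @^-1` U.
  apply/seteqP; split => [_ [p [cp Up] <-]|_ [[p cp <-]]] /=.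
    by split; [exists p|rewrite cK].
  by rewrite cK// => Up; exists p.
rewrite openE => x [Ix Ux]; apply: filterI; first exact: open_nbhs_nbhs.
by apply: (ci x Ix); exact: open_nbhs_nbhs.
Qed.

(** Off the chart image [cinv] is arbitrary; this turns equality on an open set of N into equality
    near a point of the model space, as comparing derivatives requires. *)
Lemma chart_near c U p : atlas N c -> open U -> cdom c p -> U p ->
  \forall y \near cmap c p,
    [/\ cdom c (cinv c y), U (cinv c y) & cmap c (cinv c y) = y].
Proof.
move=> Nc oU cp Up.
have : nbhs (cmap c p) (cmap c @` (cdom c `&` U)).
  by apply: open_nbhs_nbhs; split; [exact: open_chart_image|exists p].
by apply: filterS => _ [q [cq Uq] <-]; rewrite cmapK.
Qed.

Lemma smooth_fun_eq U W (f h : N -> W) : open U -> (forall p, U p -> f p = h p) ->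
  smooth_fun U f -> smooth_fun U h.
Proof.
move=> oU fh sf c Nc k; apply: Ck_eq (sf c Nc k); first exact: open_chart_image.
by move=> _ [q [cq Uq] <-] /=; rewrite cmapK//; exact: fh.
Qed.

Lemma smooth_fun_sub U V W (f : N -> W) : V `<=` U -> smooth_fun U f -> smooth_fun V f.
Proof.
move=> VU sf c Nc k; apply: Ck_sub (sf c Nc k).
by move=> _ [q [cq Uq] <-]; exists q => //; split => //; exact: VU.
Qed.

Lemma smooth_fun_cst U W (w : W) : smooth_fun U (fun=> w).
Proof. by move=> c _ k; exact: Ck_cst. Qed.

Lemma smooth_funD U W (f h : N -> W) : open U ->
  smooth_fun U f -> smooth_fun U h -> smooth_fun U (fun p => f p + h p).
Proof.
move=> oU sf sh c Nc k.
exact: CkD (open_chart_image Nc oU) (sf c Nc k) (sh c Nc k).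
Qed.

Lemma smooth_funZ U W (f : N -> R) (h : N -> W) : open U ->
  smooth_fun U f -> smooth_fun U h -> smooth_fun U (fun p => f p *: h p).
Proof.
move=> oU sf sh c Nc k.
exact: CkZ (open_chart_image Nc oU) (sf c Nc k) (sh c Nc k).
Qed.

Lemma smooth_funN U W (f : N -> W) : open U -> smooth_fun U f ->
  smooth_fun U (fun p => - f p).
Proof.
move=> oU sf; have sn := smooth_funZ oU (smooth_fun_cst U (-1 : R)) sf.
by apply: smooth_fun_eq oU _ sn => p _; rewrite scaleN1r.
Qed.

Lemma smooth_fun_linear U W W' (B : {linear W -> W'}) (f : N -> W) : open U ->
  continuous B -> smooth_fun U f -> smooth_fun U (fun p => B (f p)).
Proof.
move=> oU cB sf c Nc k; exact: Ck_linear (open_chart_image Nc oU) cB (sf c Nc k).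
Qed.

Lemma smooth_fun_comp U n (V' : set 'rV[R]_n) W (F : 'rV[R]_n -> W) (G : N -> 'rV[R]_n) :
  open U -> open V' -> (forall p, U p -> V' (G p)) -> smooth_on V' F ->
  smooth_fun U G -> smooth_fun U (F \o G).
Proof.
move=> oU oV' UV' sF sG c Nc k.
apply: Ck_comp (open_chart_image Nc oU) oV' _ (sF k) (sG c Nc k).
by move=> _ [q [cq Uq] <-] /=; rewrite cmapK//; exact: UV'.
Qed.

Lemma smooth_fun_cmap c : atlas N c -> smooth_fun (cdom c) (cmap c).
Proof. by move=> Nc d Nd; exact: atlas_compat. Qed.

Lemma smooth_fun_differentiable U W (f : N -> W) c p : smooth_fun U f -> U p ->
  atlas N c -> cdom c p -> differentiable (f \o cinv c) (cmap c p).
Proof. by move=> sf Up Nc cp; have [+ _] := sf c Nc 1; apply; exists p. Qed.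

Let dch p := chart_at_dom p.
Let ach p := chart_at_atlas p.

Lemma vderiv_near U X W (f h : N -> W) p : open U -> U p ->
  (forall q, U q -> f q = h q) -> vderiv X f p = vderiv X h p.
Proof.
move=> oU Up fh; apply: near_eq_derive.
have := chart_near (ach p) oU (dch p) Up.
by apply: filterS => y [_ /fh].
Qed.

Lemma vderiv_at X Y W (f : N -> W) p : X p = Y p -> vderiv X f p = vderiv Y f p.
Proof. by rewrite /vderiv => ->. Qed.

Lemma vderiv0 X W (f : N -> W) p : X p = 0 -> vderiv X f p = 0.
Proof. by rewrite /vderiv => ->; exact: derive0. Qed.

Section Pointwise.
Variables (U : set N) (p : N).
Hypothesis Up : U p.

Lemma vderiv_cst X W (w : W) : vderiv X (fun=> w) p = 0.
Proof. exact: derive_cst. Qed.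

Lemma vderivD X W (f h : N -> W) : smooth_fun U f -> smooth_fun U h ->
  vderiv X (fun q => f q + h q) p = vderiv X f p + vderiv X h p.
Proof.
move=> sf sh; rewrite /vderiv -deriveD//; apply: diff_derivable.
  exact: smooth_fun_differentiable sf Up (ach p) (dch p).
exact: smooth_fun_differentiable sh Up (ach p) (dch p).
Qed.

Lemma vderivN X W (f : N -> W) : smooth_fun U f ->
  vderiv X (fun q => - f q) p = - vderiv X f p.
Proof.
move=> sf; rewrite /vderiv -deriveN//; apply: diff_derivable.
exact: smooth_fun_differentiable sf Up (ach p) (dch p).
Qed.

Lemma vderivZ X W (f : N -> R) (h : N -> W) : smooth_fun U f -> smooth_fun U h ->
  vderiv X (fun q => f q *: h q) p = f p *: vderiv X h p + vderiv X f p *: h p.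
Proof.
move=> sf sh; rewrite {1}/vderiv.
have df := smooth_fun_differentiable sf Up (ach p) (dch p).
have dh := smooth_fun_differentiable sh Up (ach p) (dch p).
have [_ /(_ (X p)) E] := differentiable_scale df dh.
by rewrite /= cmapK in E.
Qed.

Lemma vderivM X (f h : N -> R) : smooth_fun U f -> smooth_fun U h ->
  vderiv X (fun q => f q * h q) p = f p * vderiv X h p + vderiv X f p * h p.
Proof. exact: vderivZ. Qed.

Lemma vderiv_linear X W W' (B : {linear W -> W'}) (f : N -> W) : continuous B ->
  smooth_fun U f -> vderiv X (fun q => B (f q)) p = B (vderiv X f p).
Proof.
move=> cB sf; rewrite {1}/vderiv.
rewrite -[LHS]/('D_(X p) (B \o (f \o cinv (chart_at p))) (cmap (chart_at p) p)).
rewrite derive_comp; last exact: linear_differentiable.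
  by rewrite deriveE ?diff_lin//; exact: linear_differentiable.
exact: smooth_fun_differentiable sf Up (ach p) (dch p).
Qed.

Lemma vderiv_dirD X Y W (f : N -> W) : smooth_fun U f ->
  vderiv (fun q => X q + Y q) f p = vderiv X f p + vderiv Y f p.
Proof.
move=> sf; apply: derive_dirD.
exact: smooth_fun_differentiable sf Up (ach p) (dch p).
Qed.

Lemma vderiv_dirZ a X W (f : N -> W) : smooth_fun U f ->
  vderiv (fun q => a q *: X q) f p = a p *: vderiv X f p.
Proof.
move=> sf; apply: derive_dirZ.
exact: smooth_fun_differentiable sf Up (ach p) (dch p).
Qed.

End Pointwise.

(** The transition map carries the components of a vector in c' to its components in c. This frees
    [vderiv] from the preferred chart in which it is defined. *)
Lemma derive_transition W (f : N -> W) c c' p v : atlas N c -> atlas N c' ->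
  cdom c p -> cdom c' p -> differentiable (f \o cinv c) (cmap c p) ->
  'D_v (f \o cinv c') (cmap c' p) =
  'D_('D_v (cmap c \o cinv c') (cmap c' p)) (f \o cinv c) (cmap c p).
Proof.
move=> Nc Nc' cp c'p df.
have E : (cmap c \o cinv c') (cmap c' p) = cmap c p by rewrite /= cmapK.
rewrite -[in RHS]E -derive_comp; last by rewrite E.
  apply: near_eq_derive; have := chart_near Nc' (open_cdom Nc) c'p cp.
  by apply: filterS => y [_ cy _] /=; rewrite cmapK.
exact: smooth_fun_differentiable (smooth_fun_cmap Nc) cp Nc' c'p.
Qed.

Lemma vderiv_chart X W (f : N -> W) c p : atlas N c -> cdom c p ->
  differentiable (f \o cinv c) (cmap c p) ->
  vderiv X f p = 'D_(vderiv X (cmap c) p) (f \o cinv c) (cmap c p).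
Proof. by move=> Nc cp df; exact: derive_transition. Qed.

(** In a fixed chart c, X(f) is the sum of the components of X in c times the partial derivatives of
    f, all of which are smooth. *)
Lemma smooth_vderiv U X W (f : N -> W) : open U -> smooth_field U X ->
  smooth_fun U f -> smooth_fun U (vderiv X f).
Proof.
move=> oU sX sf c Nc k.
have oI := open_chart_image Nc oU.
apply: (@Ck_eq _ _ _ _ _ (fun y => \sum_i (vderiv X (cmap c) \o cinv c) y 0 i *:
    'D_(delta_mx 0 i) (f \o cinv c) y)) => //.
  move=> _ [q [cq Uq] <-] /=; rewrite cmapK//.
  have df := smooth_fun_differentiable sf Uq Nc cq.
  by rewrite (vderiv_chart _ Nc cq df) derive_row.
apply: Ck_sum => // i; apply: CkZ => //; last by have [_] := sf c Nc k.+1; apply.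
apply: (Ck_coord (f := vderiv X (cmap c) \o cinv c)) oI _.
apply: Ck_sub (sX c Nc c Nc k).
by move=> _ [q [cq Uq] <-]; exists q.
Qed.

Lemma smooth_field_eq U X Y : open U -> (forall p, U p -> X p = Y p) ->
  smooth_field U X -> smooth_field U Y.
Proof.
move=> oU XY sX c Nc; apply: smooth_fun_eq (sX c Nc).
  by apply: openI => //; exact: open_cdom.
by move=> p [Up _]; apply: vderiv_at; exact: XY.
Qed.

Lemma smooth_field_sub U V X : V `<=` U -> smooth_field U X -> smooth_field V X.
Proof. by move=> VU sX c Nc; apply: smooth_fun_sub (sX c Nc) => p [/VU]. Qed.

Lemma smooth_fieldD U X Y : open U -> smooth_field U X -> smooth_field U Y ->
  smooth_field U (X \+ Y).
Proof.
move=> oU sX sY c Nc; have oUc := openI oU (open_cdom Nc).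
apply: smooth_fun_eq (smooth_funD oUc (sX c Nc) (sY c Nc)) => // p [Up cp].
by rewrite -(vderiv_dirD cp _ _ (smooth_fun_cmap Nc)).
Qed.

Lemma smooth_fieldZ U f X : open U -> smooth_fun U f -> smooth_field U X ->
  smooth_field U (vscale f X).
Proof.
move=> oU sf sX c Nc; have oUc := openI oU (open_cdom Nc).
have sfc : smooth_fun (U `&` cdom c) f by apply: smooth_fun_sub sf => p [].
apply: smooth_fun_eq (smooth_funZ oUc sfc (sX c Nc)) => // p [Up cp].
by rewrite -(vderiv_dirZ cp _ _ (smooth_fun_cmap Nc)).
Qed.

Lemma smooth_field0 U : smooth_field U (fun=> 0).
Proof.
move=> c Nc; have -> : vderiv (fun=> 0) (cmap c) = (fun=> 0 : 'rV[R]_m).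
  by apply/funext => p; exact: derive0.
exact: smooth_fun_cst.
Qed.

Lemma coord_field0 p : coord_field p 0 = (fun=> 0) :> vector_field N.
Proof. by apply/funext => q; exact: derive0. Qed.

Lemma smooth_coord_field p v : smooth_field (cdom (chart_at p)) (coord_field p v).
Proof.
move=> c Nc; have Np := ach p; have oc := open_cdom Nc; have op := open_cdom Np.
have oI := openI op oc.
(* The component row of the field in c is the v-derivative of the transition map. *)
pose F := 'D_v (cmap c \o cinv (chart_at p)).
have sF : smooth_on (cmap (chart_at p) @` (cdom (chart_at p) `&` cdom c)) F.
  by move=> k; have [_] := atlas_compat Np Nc k.+1; exact.
apply: (@smooth_fun_eq _ _ (F \o cmap (chart_at p))) => //.
  move=> q [pq cq]; rewrite /= /F.
  rewrite (derive_transition _ (ach q) Np (dch q) pq)//.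
  exact: smooth_fun_differentiable (smooth_fun_cmap Nc) cq (ach q) (dch q).
have sG : smooth_fun (cdom (chart_at p) `&` cdom c) (cmap (chart_at p)).
  by apply: smooth_fun_sub (smooth_fun_cmap Np) => q; case.
apply: (smooth_fun_comp oI (open_chart_image Np oc) _ sF sG) => q pq.
by exists q.
Qed.

Lemma lie_bracket_near U X X' Y Y' p : open U -> U p ->
  (forall q, U q -> X q = X' q) -> (forall q, U q -> Y q = Y' q) ->
  lie_bracket X Y p = lie_bracket X' Y' p.
Proof.
move=> oU Up XX' YY'.
suff H (Z Z' T T' : vector_field N) : Z p = Z' p -> (forall q, U q -> T q = T' q) ->
    vderiv Z (vderiv T (cmap (chart_at p))) p = vderiv Z' (vderiv T' (cmap (chart_at p))) p.
  by rewrite /lie_bracket (H _ _ _ _ (XX' p Up) YY') (H _ _ _ _ (YY' p Up) XX').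
move=> ZZ' TT'; rewrite (vderiv_at _ ZZ').
by apply: (vderiv_near _ oU Up) => q Uq; apply: vderiv_at; exact: TT'.
Qed.

End ManifoldCalculus.

(** * Affine connections *)

Section BilinearForm.
Variables (R : realType) (m : nat).
Implicit Types (G : 'M[R]_m) (u v w : 'rV[R]_m).

(** The value of [app2] at one point, convertible to it, so that tensor identities apply to vectors
    as well as to fields. *)
Definition bform G u v : R := (u *m G *m v^T) 0 0.

Lemma bformDl G u v w : bform G (u + v) w = bform G u w + bform G v w.
Proof. by rewrite /bform !mulmxDl mxE. Qed.

Lemma bformZl G a u w : bform G (a *: u) w = a * bform G u w.
Proof. by rewrite /bform -!scalemxAl mxE. Qed.

Lemma bformZr G a u w : bform G w (a *: u) = a * bform G w u.
Proof. by rewrite /bform linearZ /= -scalemxAr mxE. Qed.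

Lemma bformNl G u w : bform G (- u) w = - bform G u w.
Proof. by rewrite -scaleN1r bformZl mulN1r. Qed.

Lemma bformNr G u w : bform G w (- u) = - bform G w u.
Proof. by rewrite -scaleN1r bformZr mulN1r. Qed.

Lemma bform0l G w : bform G 0 w = 0.
Proof. by rewrite /bform !mul0mx mxE. Qed.

Lemma bform0r G w : bform G w 0 = 0.
Proof. by rewrite /bform trmx0 mulmx0 mxE. Qed.

Lemma bform_delta G i j : bform G (delta_mx 0 i) (delta_mx 0 j) = G i j.
Proof. by rewrite /bform trmx_delta -rowE -colE !mxE. Qed.

Lemma bformC G u w : G^T = G -> bform G u w = bform G w u.
Proof.
move=> GT; rewrite /bform -[in LHS](trmxK (u *m G *m w^T)) mxE.
by rewrite !trmx_mul trmxK GT mulmxA.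
Qed.

End BilinearForm.

Section Connection.
Variables (R : realType) (m : nat) (N : smooth_manifold R m).
Variables (D : connection N) (U : set N).
Hypotheses (oU : open U) (affD : affine_connection D).
Implicit Types (X Y Z T : vector_field N) (p : N).

(** [affine_connection] quantifies over four fields and a function at once; the zero field and the
    zero function fill the spare slots in the projections below. *)
Let s0 := @smooth_field0 R m N U.
Let c0 := smooth_fun_cst U (0 : R).

Lemma smooth_conn X Y : smooth_field U X -> smooth_field U Y -> smooth_field U (D X Y).
Proof. by move=> sX sY; have [] := affD oU sX s0 sY s0 c0. Qed.

Lemma connDl X X' Y p : smooth_field U X -> smooth_field U X' -> smooth_field U Y ->
  U p -> D (X \+ X') Y p = D X Y p + D X' Y p.
Proof. by move=> sX sX' sY Up; have [_ /(_ p Up)[]] := affD oU sX sX' sY s0 c0. Qed.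

Lemma connZl f X Y p : smooth_fun U f -> smooth_field U X -> smooth_field U Y ->
  U p -> D (vscale f X) Y p = f p *: D X Y p.
Proof. by move=> sf sX sY Up; have [_ /(_ p Up)[]] := affD oU sX s0 sY s0 sf. Qed.

Lemma connDr X Y Y' p : smooth_field U X -> smooth_field U Y -> smooth_field U Y' ->
  U p -> D X (Y \+ Y') p = D X Y p + D X Y' p.
Proof. by move=> sX sY sY' Up; have [_ /(_ p Up)[]] := affD oU sX s0 sY sY' c0. Qed.

Lemma connZr f X Y p : smooth_fun U f -> smooth_field U X -> smooth_field U Y ->
  U p -> D X (vscale f Y) p = vderiv X f p *: Y p + f p *: D X Y p.
Proof. by move=> sf sX sY Up; have [_ /(_ p Up)[]] := affD oU sX s0 sY s0 sf. Qed.

(* A field vanishing on U equals its product with the indicator of the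
   complement of U, a function that is smooth on U. *)
Lemma conn_vanish Z T p : U p -> (forall q, U q -> Z q = 0) -> smooth_field U T ->
  D Z T p = 0 /\ D T Z p = 0.
Proof.
move=> Up Z0 sT; pose f (q : N) : R := (~~ `[< U q >])%:R.
have f0 q : U q -> f q = 0 by move=> Uq; rewrite /f asboolT.
have sf : smooth_fun U f.
  by apply: smooth_fun_eq c0 => // q Uq; rewrite f0.
have sZ : smooth_field U Z by apply: smooth_field_eq s0 => // q /Z0.
have ZE : Z = vscale f Z.
  apply/funext => q; rewrite /vscale; have [Uq|nUq] := pselect (U q).
    by rewrite Z0// scaler0.
  by rewrite /f asboolF// scale1r.
split; first by rewrite ZE connZl// f0// scale0r.
by rewrite ZE connZr// f0// scale0r Z0// scaler0 addr0.
Qed.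

(** The differences X' - X and Y' - Y vanish on U, so additivity reduces locality to [conn_vanish];
    no cut-off function is involved. *)
Lemma conn_near X X' Y Y' p : U p ->
  (forall q, U q -> X q = X' q) -> (forall q, U q -> Y q = Y' q) ->
  smooth_field U X -> smooth_field U Y -> D X Y p = D X' Y' p.
Proof.
move=> Up XX' YY' sX sY.
have sX' : smooth_field U X' by apply: smooth_field_eq sX.
have sY' : smooth_field U Y' by apply: smooth_field_eq sY.
pose Z q := X' q - X q; pose T q := Y' q - Y q.
have Z0 q : U q -> Z q = 0 by move=> Uq; rewrite /Z XX'// subrr.
have T0 q : U q -> T q = 0 by move=> Uq; rewrite /T YY'// subrr.
have sZ : smooth_field U Z by apply: smooth_field_eq s0 => // q /Z0.
have sT : smooth_field U T by apply: smooth_field_eq s0 => // q /T0.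
have -> : X' = X \+ Z by apply/funext => q; rewrite /Z /= addrC subrK.
have -> : Y' = Y \+ T by apply/funext => q; rewrite /T /= addrC subrK.
have sXZ := smooth_fieldD oU sX sZ.
rewrite connDr// (conn_vanish Up T0 sXZ).2 addr0.
by rewrite connDl// (conn_vanish Up Z0 sY).1 addr0.
Qed.

Hypothesis tfD : torsion_free D.

(* The bracket is defined through the preferred chart at each point; its smoothness
   is inherited from D by torsion-freeness, which avoids symmetry of second derivatives. *)
Lemma smooth_lie_bracket X Y : smooth_field U X -> smooth_field U Y ->
  smooth_field U (lie_bracket X Y).
Proof.
move=> sX sY.
have sS : smooth_field U (D X Y \+ vscale (fun=> -1) (D Y X)).
  apply: smooth_fieldD oU (smooth_conn sX sY) _.
  exact: smooth_fieldZ oU (smooth_fun_cst _ _) (smooth_conn sY sX).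
apply: smooth_field_eq oU _ sS => q Uq.
by rewrite /vscale /= scaleN1r (tfD oU).
Qed.

Lemma lie_bracket_vanish Z T p : U p -> (forall q, U q -> Z q = 0) ->
  smooth_field U T -> lie_bracket Z T p = 0 /\ lie_bracket T Z p = 0.
Proof.
move=> Up Z0 sT; have sZ : smooth_field U Z by apply: smooth_field_eq s0 => // q /Z0.
have [v1 v2] := conn_vanish Up Z0 sT.
by split; [rewrite -(tfD oU sZ sT Up)|rewrite -(tfD oU sT sZ Up)]; rewrite v1 v2 subrr.
Qed.

(** This and the next two lemmas stand in for tensoriality. The vanishing slot will hold the
    horizontal part of xi or the projection to N of the coordinate field d/dt. *)
Lemma curvature_vanish1 X Y Z p : U p -> (forall q, U q -> X q = 0) ->
  smooth_field U Y -> smooth_field U Z -> curvature D X Y Z p = 0.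
Proof.
move=> Up X0 sY sZ.
have DXZ0 q : U q -> D X Z q = 0 by move=> Uq; have [] := conn_vanish Uq X0 sZ.
have XY0 q : U q -> lie_bracket X Y q = 0.
  by move=> Uq; have [] := lie_bracket_vanish Uq X0 sY.
have [e1 _] := conn_vanish Up X0 (smooth_conn sY sZ).
have [_ e2] := conn_vanish Up DXZ0 sY.
have [e3 _] := conn_vanish Up XY0 sZ.
by rewrite /curvature e1 e2 e3 !subr0.
Qed.

Lemma curvature_vanish2 X Y Z p : U p -> (forall q, U q -> Y q = 0) ->
  smooth_field U X -> smooth_field U Z -> curvature D X Y Z p = 0.
Proof.
move=> Up Y0 sX sZ.
have DYZ0 q : U q -> D Y Z q = 0 by move=> Uq; have [] := conn_vanish Uq Y0 sZ.
have XY0 q : U q -> lie_bracket X Y q = 0.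
  by move=> Uq; have [] := lie_bracket_vanish Uq Y0 sX.
have [_ e1] := conn_vanish Up DYZ0 sX.
have [e2 _] := conn_vanish Up Y0 (smooth_conn sX sZ).
have [e3 _] := conn_vanish Up XY0 sZ.
by rewrite /curvature e1 e2 e3 !subr0.
Qed.

Lemma curvature_vanish3 X Y Z p : U p -> (forall q, U q -> Z q = 0) ->
  smooth_field U X -> smooth_field U Y -> curvature D X Y Z p = 0.
Proof.
move=> Up Z0 sX sY.
have DZ0 T q : smooth_field U T -> U q -> D T Z q = 0.
  by move=> sT Uq; have [] := conn_vanish Uq Z0 sT.
have [_ e1] := conn_vanish Up (fun q => DZ0 Y q sY) sX.
have [_ e2] := conn_vanish Up (fun q => DZ0 X q sX) sY.
have [_ e3] := conn_vanish Up Z0 (smooth_lie_bracket sX sY).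
by rewrite /curvature e1 e2 e3 !subr0.
Qed.

Lemma curvature_near X X' Y Y' Z Z' p : U p ->
  (forall q, U q -> X q = X' q) -> (forall q, U q -> Y q = Y' q) ->
  (forall q, U q -> Z q = Z' q) ->
  smooth_field U X -> smooth_field U Y -> smooth_field U Z ->
  curvature D X Y Z p = curvature D X' Y' Z' p.
Proof.
move=> Up XX' YY' ZZ' sX sY sZ; rewrite /curvature.
have YZ q : U q -> D Y Z q = D Y' Z' q by move=> Uq; exact: conn_near Uq YY' ZZ' sY sZ.
have XZ q : U q -> D X Z q = D X' Z' q by move=> Uq; exact: conn_near Uq XX' ZZ' sX sZ.
have XY q : U q -> lie_bracket X Y q = lie_bracket X' Y' q.
  by move=> Uq; exact: lie_bracket_near oU Uq XX' YY'.
have e1 := conn_near Up XX' YZ sX (smooth_conn sY sZ).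
have e2 := conn_near Up YY' XZ sY (smooth_conn sX sZ).
have e3 := conn_near Up XY ZZ' (smooth_lie_bracket sX sY) sZ.
pose B (u v : 'rV[R]_m) := u - v.
exact: (congr2 B (congr2 B e1 e2) e3).
Qed.

Lemma ricciE Y Z p :
  ricci D Y Z p = \sum_j curvature D (coord_field p (delta_mx 0 j)) Y Z p 0 j.
Proof. by apply: eq_bigr => j _; rewrite mxE. Qed.

(** U lies in the preferred chart domain because the trace runs over coordinate fields, known to be
    smooth only there. *)
Lemma ricci_near Y Y' Z Z' p : U p -> U `<=` cdom (chart_at p) ->
  (forall q, U q -> Y q = Y' q) -> (forall q, U q -> Z q = Z' q) ->
  smooth_field U Y -> smooth_field U Z -> ricci D Y Z p = ricci D Y' Z' p.
Proof.
move=> Up UC YY' ZZ' sY sZ; rewrite !ricciE; apply: eq_bigr => j _.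
have sE := smooth_field_sub UC (smooth_coord_field p (delta_mx 0 j)).
have EE q : U q -> coord_field p (delta_mx 0 j) q = coord_field p (delta_mx 0 j) q by [].
have e := curvature_near Up EE YY' ZZ' sE sY sZ.
by have := congr1 (fun w : 'rV[R]_m => w 0 j) e.
Qed.

Lemma ricci_vanish1 Y Z p : U p -> U `<=` cdom (chart_at p) ->
  (forall q, U q -> Y q = 0) -> smooth_field U Z -> ricci D Y Z p = 0.
Proof.
move=> Up UC Y0 sZ; rewrite ricciE big1// => j _.
have sE := smooth_field_sub UC (smooth_coord_field p (delta_mx 0 j)).
by rewrite (curvature_vanish2 Up Y0 sE sZ) mxE.
Qed.

Lemma ricci_vanish2 Y Z p : U p -> U `<=` cdom (chart_at p) ->
  (forall q, U q -> Z q = 0) -> smooth_field U Y -> ricci D Y Z p = 0.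
Proof.
move=> Up UC Z0 sY; rewrite ricciE big1// => j _.
have sE := smooth_field_sub UC (smooth_coord_field p (delta_mx 0 j)).
by rewrite (curvature_vanish3 Up Z0 sE sY) mxE.
Qed.

Variable g : two_tensor N.
Hypotheses (gC : forall p, (g p)^T = g p) (mD : metric_connection g D).

(** Metric compatibility gives three sums, torsion-freeness three differences, of the six numbers
    g(D_S T, V). The right-hand side involves only the metric and brackets, so it can be compared
    between M and N. *)
Lemma koszul X Y Z p : smooth_field U X -> smooth_field U Y -> smooth_field U Z ->
  U p -> 2 * app2 g (D X Y) Z p =
    vderiv X (app2 g Y Z) p + vderiv Y (app2 g X Z) p - vderiv Z (app2 g X Y) p
    + app2 g (lie_bracket X Y) Z p - app2 g (lie_bracket X Z) Y p
    - app2 g (lie_bracket Y Z) X p.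
Proof.
move=> sX sY sZ Up; pose b (u v : 'rV[R]_m) := bform (g p) u v.
have bC u v : b u v = b v u by exact: bformC.
have bB u v w : b (u - v) w = b u w - b v w by rewrite /b bformDl bformNl.
have m1 : vderiv X (app2 g Y Z) p = b (D X Y p) (Z p) + b (D X Z p) (Y p).
  by rewrite (bC _ (Y p)); exact: mD oU _ _ _ sX sY sZ p Up.
have m2 : vderiv Y (app2 g X Z) p = b (D Y X p) (Z p) + b (D Y Z p) (X p).
  by rewrite (bC _ (X p)); exact: mD oU _ _ _ sY sX sZ p Up.
have m3 : vderiv Z (app2 g X Y) p = b (D Z X p) (Y p) + b (D Z Y p) (X p).
  by rewrite (bC _ (X p)); exact: mD oU _ _ _ sZ sX sY p Up.
have tE S T : smooth_field U S -> smooth_field U T -> forall w,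
    b (lie_bracket S T p) w = b (D S T p) w - b (D T S p) w.
  by move=> sS sT w; rewrite -bB (tfD oU sS sT Up).
have tXY : app2 g (lie_bracket X Y) Z p = _ := tE X Y sX sY (Z p).
have tXZ : app2 g (lie_bracket X Z) Y p = _ := tE X Z sX sZ (Y p).
have tYZ : app2 g (lie_bracket Y Z) X p = _ := tE Y Z sY sZ (X p).
(* a1, ..., a6 stand for g(D_X Y, Z), g(D_Y X, Z), g(D_X Z, Y), g(D_Z X, Y), g(D_Y Z, X), g(D_Z Y,
   X). *)
have alg (v1 v2 v3 b1 b2 b3 a1 a2 a3 a4 a5 a6 : R) : v1 = a1 + a3 -> v2 = a2 + a5 ->
    v3 = a4 + a6 -> b1 = a1 - a2 -> b2 = a3 - a4 -> b3 = a5 - a6 ->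
    2 * a1 = v1 + v2 - v3 + b1 - b2 - b3.
  by move=> -> -> -> -> -> ->; ring.
exact: (alg _ _ _ _ _ _ _ _ _ _ _ _ m1 m2 m3 tXY tXZ tYZ).
Qed.

End Connection.

(** * The product of a line with a manifold *)

Section LineProduct.
Variables (R : realType) (m : nat) (N : smooth_manifold R m).
Local Notation M := (line_product N).
Implicit Types (U : set N) (X Y Z : vector_field N) (x : M) (W : normedModType R).

(** The fields and functions in play do not depend on t, so open sets saturated along the line
    suffice. *)
Definition cyl U : set M := [set x | U x.2].

Lemma open_cyl U : open U -> open (cyl U).
Proof. by move=> oU; apply: open_comp oU => x _; exact: cvg_snd. Qed.

Lemma smooth_fun_cyl U W (h : N -> W) : open U -> smooth_fun U h ->
  smooth_fun (cyl U) (fun x => h x.2).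
Proof.
move=> oU sh _ [c Nc <-] k.
have oI := open_chart_image Nc oU.
have c0 : continuous (\0 : {linear 'rV[R]_(1 + m) -> W}) by exact: cst_continuous.
have cid : continuous (idfun : {linear W -> W}) by move=> y; exact: cvg_id.
have cr : continuous (rsubmx : {linear 'rV[R]_(1 + m) -> 'rV[R]_m}).
  exact: continuous_rsubmx.
have CA := Ck_affcomp 0 cr cid c0 oI (sh c Nc k).
have oA : open (rsubmx @^-1` (cmap c @` (cdom c `&` U)) : set 'rV[R]_(1 + m)).
  by apply: open_comp oI => y _; exact: cr.
have {}CA : Ck k (rsubmx @^-1` (cmap c @` (cdom c `&` U)) : set 'rV[R]_(1 + m))
    ((fun x => h x.2) \o cinv (line_chart c)).
  by apply: Ck_eq oA _ CA => y _ /=; rewrite !add0r.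
apply: Ck_sub CA => _ [x [cx Ux] <-] /=.
by exists x.2 => //; rewrite row_mxKr.
Qed.

Lemma vderiv_cyl (T : vector_field M) X W (h : N -> W) x :
  rsubmx (T x) = X x.2 -> vderiv T (fun y => h y.2) x = vderiv X h x.2.
Proof.
move=> TX; rewrite /vderiv /derive -TX.
(* The two difference quotients are the same function of s, so their limits agree by definition. *)
set F := (X in lim (X @ _)); set G := (X in _ = lim (X @ _)).
suff -> : F = G by [].
apply/funext => s; rewrite /F /G /=.
have rE (v w : 'rV[R]_(1 + m)) : rsubmx (s *: v + w) = s *: rsubmx v + rsubmx w.
  by apply/rowP => i; rewrite !mxE.
by rewrite rE row_mxKr.
Qed.

(** With the projection [prL] to the line, [emb] puts (t, F) in the form constant plus linear plus
    [emb] of F after [rsubmx], to which [differentiable_affcomp] applies. *)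
Let emb : {linear 'rV[R]_m -> 'rV[R]_(1 + m)} := mulmxr (row_mx 0 1%:M).
Let prL : {linear 'rV[R]_(1 + m) -> 'rV[R]_(1 + m)} :=
  mulmxr (block_mx 1%:M 0 0 0).

Let embE u : emb u = row_mx 0 u.
Proof. by rewrite /emb /= mul_mx_row mulmx0 mulmx1. Qed.

Let prLE w : prL w = row_mx (lsubmx w) 0.
Proof.
rewrite /prL /= -[in LHS](hsubmxK w) mul_row_block !mulmx0 mulmx1 !addr0.
by [].
Qed.

(** The chart c need not be preferred at x: with c preferred it computes [vderiv], with c centred
    elsewhere it computes [coord_field]. *)
Lemma derive_line_chart U (F : N -> 'rV[R]_m) c x (w : 'rV[R]_(1 + m)) :
  smooth_fun U F -> U x.2 -> atlas N c -> cdom c x.2 ->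
  'D_w ((fun y : M => row_mx (y.1)%:M (F y.2)) \o cinv (line_chart c))
    (cmap (line_chart c) x) =
  row_mx (lsubmx w) ('D_(rsubmx w) (F \o cinv c) (cmap c x.2)).
Proof.
move=> sF Ux Nc cx.
have dF := smooth_fun_differentiable sF Ux Nc cx.
have cr : continuous (rsubmx : {linear 'rV[R]_(1 + m) -> 'rV[R]_m}).
  exact: continuous_rsubmx.
have ce : continuous emb by exact: continuous_mulmxr.
have cp : continuous prL by exact: continuous_mulmxr.
pose y0 : 'rV[R]_(1 + m) := row_mx (x.1)%:M (cmap c x.2).
have yr : rsubmx y0 = cmap c x.2 by rewrite row_mxKr.
rewrite -yr in dF.
have E : 'D_w (fun y => 0 + prL y + emb ((F \o cinv c) (rsubmx y))) y0 =
    prL w + emb ('D_(rsubmx w) (F \o cinv c) (rsubmx y0)).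
  by have [_ ->] := differentiable_affcomp 0 cr ce cp dF.
rewrite embE prLE add_row_mx addr0 add0r yr in E.
rewrite -[RHS]E.
set f1 := (X in 'D_ _ X _); set f2 := (X in _ = 'D_ _ X _).
suff -> : f1 = f2 by [].
apply/funext => y; rewrite /f1 /f2 embE prLE add0r add_row_mx addr0 add0r /=.
by rewrite -mx11_scalar.
Qed.

Lemma vderiv_fst (T : vector_field M) X U (F : N -> 'rV[R]_m) x :
  smooth_fun U F -> U x.2 -> rsubmx (T x) = X x.2 ->
  vderiv T (fun y : M => row_mx (y.1)%:M (F y.2)) x =
  row_mx (lsubmx (T x)) (vderiv X F x.2).
Proof.
move=> sF Ux TX.
have := derive_line_chart (T x) sF Ux (chart_at_atlas x.2) (chart_at_dom x.2).
by rewrite TX.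
Qed.

Let row_split (a : R) (u : 'rV[R]_m) : row_mx a%:M u = a *: row_mx 1%:M 0 + emb u.
Proof. by rewrite embE scale_row_mx scaler0 scale_scalar_mx mulr1 add_row_mx addr0 add0r. Qed.

Let sm_emb U (F : N -> 'rV[R]_m) : open U -> smooth_fun U F ->
  smooth_fun U (fun p => emb (F p)).
Proof. by move=> oU; apply: smooth_fun_linear => //; exact: continuous_mulmxr. Qed.

Lemma smooth_row U (a : N -> R) (F : N -> 'rV[R]_m) : open U -> smooth_fun U a ->
  smooth_fun U F -> smooth_fun U (fun p => row_mx (a p)%:M (F p) : 'rV[R]_(1 + m)).
Proof.
move=> oU sa sF; have sE := sm_emb oU sF.
have s1 := smooth_funZ oU sa (smooth_fun_cst U (row_mx 1%:M 0 : 'rV[R]_(1 + m))).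
by apply: smooth_fun_eq oU _ (smooth_funD oU s1 sE) => p _; rewrite -row_split.
Qed.

Lemma vderiv_row U X (a : N -> R) (F : N -> 'rV[R]_m) p : open U -> U p ->
  smooth_fun U a -> smooth_fun U F ->
  vderiv X (fun q => row_mx (a q)%:M (F q) : 'rV[R]_(1 + m)) p =
  row_mx (vderiv X a p)%:M (vderiv X F p).
Proof.
move=> oU Up sa sF; have sE := sm_emb oU sF.
have scst := smooth_fun_cst U (row_mx 1%:M 0 : 'rV[R]_(1 + m)).
have s1 := smooth_funZ oU sa scst.
under eq_fun do rewrite row_split.
rewrite (vderivD Up _ s1 sE) (vderivZ Up _ sa scst) (vderiv_linear Up _ _ sF).
  by rewrite (vderiv_cst p X) scaler0 add0r -row_split.
exact: continuous_mulmxr.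
Qed.

End LineProduct.

(** * Fields X^L + f xi: smoothness, derivatives and brackets *)

Section LiftedFields.
Variables (R : realType) (m : nat) (N : smooth_manifold R m) (tau : one_form N).
Local Notation M := (line_product N).
Implicit Types (U : set N) (X Y Z : vector_field N) (x : M) (f h : N -> R).

(* The vector of T_(t,p) (R x N) with eta-component a and projection u to T_p N. *)
Definition lift_vec (t : 'cV[R]_m) (a : R) (u : 'rV[R]_m) : 'rV[R]_(1 + m) :=
  row_mx (a - (u *m t) 0 0)%:M u.

(* X^L + f xi *)
Definition lift_field X f : vector_field M := fun x => lift_vec (tau x.2) (f x.2) (X x.2).

Lemma horizontal_liftE X : horizontal_lift tau X = lift_field X (fun=> 0).
Proof. by apply/funext => x; rewrite /lift_field /lift_vec sub0r. Qed.

Lemma lift_vecD t a b u v : lift_vec t (a + b) (u + v) = lift_vec t a u + lift_vec t b v.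
Proof.
rewrite /lift_vec add_row_mx mulmxDl mxE -raddfD /=.
by rewrite opprD addrACA.
Qed.

Lemma lift_vecN t a u : lift_vec t (- a) (- u) = - lift_vec t a u.
Proof. by rewrite /lift_vec opp_row_mx mulNmx [X in _ - X]mxE -opprD raddfN. Qed.

Lemma lift_vecB t a b u v : lift_vec t (a - b) (u - v) = lift_vec t a u - lift_vec t b v.
Proof. by rewrite lift_vecD lift_vecN. Qed.

Lemma lift_vecP t (w : 'rV[R]_(1 + m)) :
  w = lift_vec t (lsubmx w 0 0 + (rsubmx w *m t) 0 0) (rsubmx w).
Proof. by rewrite /lift_vec addrK -mx11_scalar hsubmxK. Qed.

Lemma rsubmx_lift_field X f x : rsubmx (lift_field X f x) = X x.2.
Proof. exact: row_mxKr. Qed.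

Lemma lsubmx_lift_field X f x :
  lsubmx (lift_field X f x) = (f x.2 - app1 tau X x.2)%:M.
Proof. exact: row_mxKl. Qed.

Lemma coord_field_lift x (w : 'rV[R]_(1 + m)) y : cyl (cdom (chart_at x.2)) y ->
  coord_field x w y = lift_field (coord_field x.2 (rsubmx w))
    (fun p => lsubmx w 0 0 + app1 tau (coord_field x.2 (rsubmx w)) p) y.
Proof.
move=> xy; rewrite /lift_field /lift_vec addrK -mx11_scalar.
exact: derive_line_chart w (smooth_fun_cmap (chart_at_atlas y.2))
  (chart_at_dom y.2) (chart_at_atlas x.2) xy.
Qed.

Hypothesis stau : smooth_one_form tau.

Lemma smooth_vert U X f : open U -> smooth_field U X -> smooth_fun U f ->
  smooth_fun U (fun p => f p - app1 tau X p).
Proof.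
move=> oU sX sf; exact: smooth_funD oU sf (smooth_funN oU (stau oU sX)).
Qed.

Lemma vderiv_lift_cmap U X f c x : open U -> smooth_field U X ->
  atlas N c -> U x.2 -> cdom c x.2 ->
  vderiv (lift_field X f) (cmap (line_chart c)) x =
  row_mx (f x.2 - app1 tau X x.2)%:M (vderiv X (cmap c) x.2).
Proof.
move=> oU sX Nc Ux cx; rewrite -lsubmx_lift_field.
exact: vderiv_fst (smooth_fun_cmap Nc) cx (rsubmx_lift_field X f x).
Qed.

Lemma smooth_lift_field U X f : open U -> smooth_field U X -> smooth_fun U f ->
  smooth_field (cyl U) (lift_field X f).
Proof.
move=> oU sX sf _ [c Nc <-].
have oI := openI oU (open_cdom Nc).
have sI : smooth_fun (U `&` cdom c) (fun p => f p - app1 tau X p).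
  by apply: smooth_fun_sub (smooth_vert oU sX sf) => p; case.
have sr := smooth_fun_cyl oI (smooth_row oI sI (sX c Nc)).
apply: smooth_fun_eq (open_cyl oI) _ sr => x [Ux cx].
by rewrite (vderiv_lift_cmap f oU sX Nc Ux cx).
Qed.

(** The d/dt entry of Y^L + h xi is h - tau(Y), a function pulled back from N, so only the
    projection X of the outer field differentiates it. *)
Let vderiv_lift2 U X Y f h x : open U -> U x.2 ->
  smooth_field U X -> smooth_field U Y -> smooth_fun U f -> smooth_fun U h ->
  vderiv (lift_field X f) (vderiv (lift_field Y h) (cmap (chart_at x))) x =
  row_mx (vderiv X h x.2 - vderiv X (app1 tau Y) x.2)%:M
    (vderiv X (vderiv Y (cmap (chart_at x.2))) x.2).
Proof.
move=> oU Ux sX sY sf sh.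
have Nx := chart_at_atlas x.2; have dx := chart_at_dom x.2.
have oI := openI oU (open_cdom Nx).
have Ix : (U `&` cdom (chart_at x.2)) x.2 by [].
have sI : smooth_fun (U `&` cdom (chart_at x.2)) (fun p => h p - app1 tau Y p).
  by apply: smooth_fun_sub (smooth_vert oU sY sh) => p; case.
have E1 : vderiv (lift_field X f) (vderiv (lift_field Y h) (cmap (chart_at x))) x =
    vderiv (lift_field X f) (fun y : M => row_mx (h y.2 - app1 tau Y y.2)%:M
      (vderiv Y (cmap (chart_at x.2)) y.2)) x.
  apply: (vderiv_near _ (open_cyl oI) Ix) => y [Uy cy].
  exact: (vderiv_lift_cmap h oU sY Nx Uy cy).
have E2 := vderiv_cyl (fun p => row_mx (h p - app1 tau Y p)%:M
      (vderiv Y (cmap (chart_at x.2)) p) : 'rV[R]_(1 + m)) (rsubmx_lift_field X f x).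
have E3 := vderiv_row X oI Ix sI (sY _ Nx).
have sn := smooth_funN oU (stau oU sY).
have E4 : vderiv X (fun p => h p - app1 tau Y p) x.2 =
    vderiv X h x.2 - vderiv X (app1 tau Y) x.2.
  have := congr1 (+%R (vderiv X h x.2)) (vderivN Ux X (stau oU sY)).
  exact: etrans (vderivD Ux X sh sn).
rewrite E4 in E3.
exact: etrans E1 (etrans E2 E3).
Qed.

Lemma lie_bracket_lift U X Y f h x : open U -> U x.2 ->
  smooth_field U X -> smooth_field U Y -> smooth_fun U f -> smooth_fun U h ->
  lie_bracket (lift_field X f) (lift_field Y h) x =
  lift_field (lie_bracket X Y)
    (fun p => vderiv X h p - vderiv Y f p - 2 * ext_deriv tau X Y p) x.
Proof.
move=> oU Ux sX sY sf sh.
have E1 := vderiv_lift2 oU Ux sX sY sf sh.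
have E2 := vderiv_lift2 oU Ux sY sX sh sf.
(* Here e is tau([X, Y]), which [lift_vec] subtracts; it completes X(tau(Y)) - Y(tau(X)) to twice
   the exterior derivative. *)
have alg (a b c d e : R) (u v : 'rV[R]_m) : row_mx (a - b)%:M u - row_mx (c - d)%:M v =
    row_mx (a - c - 2 * (2^-1 * (b - d - e)) - e)%:M (u - v) :> 'rV[R]_(1 + m).
  rewrite opp_row_mx add_row_mx -raddfB; congr (row_mx _%:M _).
  by field.
have := congr2 (fun u v : 'rV[R]_(1 + m) => u - v) E1 E2.
by rewrite (alg _ _ _ _ (app1 tau (lie_bracket X Y) x.2)).
Qed.

End LiftedFields.

(** * Geometry of the Sasakian lift *)

Section PositiveDefinite.
Variables (R : realType) (m : nat).

Lemma posdef_unitmx (A : 'M[R]_m) :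
  (forall v : 'rV[R]_m, v != 0 -> 0 < (v *m A *m v^T) 0 0) -> A \in unitmx.
Proof.
move=> pA; rewrite -row_free_unit -kermx_eq0; apply/rowV0P => v /sub_kermxP vA.
by apply/eqP; apply/negPn/negP => /pA; rewrite vA mul0mx mxE ltxx.
Qed.

Lemma sum_delta_mul (A : 'M[R]_m) : \sum_j ((delta_mx 0 j : 'rV_m) *m A) 0 j = \tr A.
Proof. by apply: eq_bigr => j _; rewrite -rowE mxE. Qed.

Lemma scale_mul11 (A : 'M[R]_1) (v : 'rV[R]_m) : A 0 0 *: v = A *m v.
Proof. by rewrite [in RHS](mx11_scalar A) mul_scalar_mx. Qed.

Lemma mxtrace_mul_row (u : 'rV[R]_m) (v : 'cV[R]_m) : \tr (v *m u) = (u *m v) 0 0.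
Proof. by rewrite mxtrace_mulC /mxtrace big_ord1. Qed.

End PositiveDefinite.

(** * The lifted metric at one point *)

Section LiftedMetric.
Variables (R : realType) (m : nat) (t : 'cV[R]_m) (B : 'M[R]_m).
Let E : 'cV[R]_(1 + m) := col_mx 1%:M t.
Definition lift_form : 'M[R]_(1 + m) := E *m E^T + block_mx 0 0 0 B.

Lemma lift_formE : lift_form = block_mx 1%:M t^T t (t *m t^T + B).
Proof.
rewrite /lift_form /E tr_col_mx mul_col_row trmx1 !mul1mx mulmx1 add_block_mx.
by rewrite !addr0.
Qed.

(** The column E is eta, which takes the value a on [lift_vec t a u], while the block term sees only
    u: in these coordinates the metric is diagonal. *)
Lemma bform_lift a b u v :
  bform lift_form (lift_vec t a u) (lift_vec t b v) = a * b + bform B u v.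
Proof.
have eta c w : lift_vec t c w *m E = c%:M.
  rewrite /lift_vec /E mul_row_col mulmx1 [X in _ + X]mx11_scalar -raddfD /=.
  by rewrite subrK.
rewrite /bform /lift_form mulmxDr mulmxDl mxE; congr (_ + _).
  rewrite mulmxA eta -mulmxA -trmx_mul eta tr_scalar_mx -scalar_mxM.
  by rewrite mxE eqxx mulr1n.
rewrite /lift_vec mul_row_block !mulmx0 !add0r tr_row_mx mul_row_col mul0mx.
by rewrite add0r.
Qed.

Lemma lift_formC : B^T = B -> lift_form^T = lift_form.
Proof.
by move=> BC; rewrite lift_formE tr_block_mx trmx1 trmxK raddfD /= trmx_mul trmxK BC.
Qed.

Hypothesis pB : forall v : 'rV[R]_m, v != 0 -> 0 < bform B v v.

Lemma posdef_lift_form (w : 'rV[R]_(1 + m)) : w != 0 -> 0 < bform lift_form w w.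
Proof.
move=> w0; rewrite (lift_vecP t w) bform_lift.
set a := (lsubmx w 0 0 + _); have [u0|u0] := eqVneq (rsubmx w) 0; last first.
  by rewrite ltr_wpDl ?pB// -expr2 sqr_ge0.
rewrite u0 bform0l addr0 -expr2 exprn_even_gt0//=.
apply: contra w0 => /eqP a0; rewrite (lift_vecP t w) -/a a0 u0 /lift_vec.
by rewrite mul0mx mxE subr0 raddf0 row_mx0.
Qed.

(** Nondegeneracy, in the form that identifies a covariant derivative from its products with test
    vectors. *)
Lemma lift_form_inj (w w' : 'rV[R]_(1 + m)) :
  (forall b v, bform lift_form w (lift_vec t b v) = bform lift_form w' (lift_vec t b v)) ->
  w = w'.
Proof.
move=> ww'; apply/eqP; rewrite -subr_eq0; apply/negPn/negP => /posdef_lift_form.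
by rewrite [X in bform _ _ X](lift_vecP t) bformDl bformNl ww' subrr ltxx.
Qed.

(* g^L-trace of the pull-back to R x N of a bilinear form on N. *)
Lemma mxtrace_inv_lift_form (C : 'M[R]_m) :
  \tr (invmx lift_form *m block_mx 0 0 0 C) = \tr (invmx B *m C).
Proof.
have uB : B \in unitmx by exact: posdef_unitmx.
have uG : lift_form \in unitmx by apply: posdef_unitmx; exact: posdef_lift_form.
pose K := invmx B *m C.
(* Solving for the right factor blockwise gives K in the corner and -t^T K above it; only K meets
   the diagonal. *)
have -> : block_mx 0 0 0 C =
      lift_form *m block_mx 0 (- (t^T *m K)) 0 K :> 'M[R]_(1 + m).
  rewrite lift_formE mulmx_block !mulmx0 !addr0 mul1mx addNr mulmxN mulmxDl.
  by rewrite mulmxA addrA addNr add0r /K mulKVmx.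
by rewrite mulKmx// mxtrace_block mxtrace0 add0r.
Qed.

End LiftedMetric.

(** * The Levi-Civita connection of the lifted metric *)

Section SasakianConnection.
Variables (R : realType) (m : nat) (N : smooth_manifold R m).
Variables (J : endomorphism N) (g : two_tensor N) (tau : one_form N).
Variables (D : connection N) (DL : connection (line_product N)).
Local Notation M := (line_product N).
Local Notation G := (cm_metric (sasakian_lift J g tau)).
Local Notation L := (lift_field tau).
Implicit Types (U : set N) (X Y Z : vector_field N) (f h k : N -> R) (x : M) (p : N).

Hypothesis kJ : kahler J g D.
Hypothesis stau : smooth_one_form tau.
Hypothesis dtau : forall U, open U -> forall X Y, smooth_field U X -> smooth_field U Y ->
  forall p, U p -> kahler_form J g X Y p = ext_deriv tau X Y p.
Hypothesis lcDL : levi_civita G DL.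

Let gR : riemannian_metric g. Proof. by case: kJ. Qed.
Let gC p : (g p)^T = g p. Proof. by case: gR. Qed.
Let gP p (v : 'rV[R]_m) : v != 0 -> 0 < bform (g p) v v.
Proof. by case: gR => _ _; exact. Qed.
Let sg : smooth_two_tensor g. Proof. by case: gR. Qed.
Let lcD : levi_civita g D. Proof. by case: kJ. Qed.
Let affD : affine_connection D. Proof. by case: lcD. Qed.
Let tfD : torsion_free D. Proof. by case: lcD. Qed.
Let mD : metric_connection g D. Proof. by case: lcD. Qed.
Let affDL : affine_connection DL. Proof. by case: lcDL. Qed.
Let tfDL : torsion_free DL. Proof. by case: lcDL. Qed.
Let mDL : metric_connection G DL. Proof. by case: lcDL. Qed.
Let sJ : smooth_endomorphism J. Proof. by case: kJ => _ _ []. Qed.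
Let JJ p : J p *m J p = - 1%:M. Proof. by case: kJ => _ _ []. Qed.
Let DJ U : open U -> forall X Y, smooth_field U X -> smooth_field U Y ->
  forall p, U p -> D X (appE J Y) p = D X Y p *m J p.
Proof. by move=> oU X Y sX sY p Up; have [_ _ _ _ H] := kJ; exact: H oU _ _ sX sY p Up. Qed.

Let Jg p u v : bform (g p) (u *m J p) (v *m J p) = bform (g p) u v.
Proof.
(* The Hermitian condition is assumed for arbitrary maps, so constant ones give it for vectors. *)
by have [_ _ _ H _] := kJ; exact: H (fun=> u) (fun=> v) p.
Qed.

Lemma mulJJ p (u : 'rV[R]_m) : u *m J p *m J p = - u.
Proof. by rewrite -mulmxA JJ mulmxN mulmx1. Qed.

Lemma bformJ p (u v : 'rV[R]_m) : bform (g p) (u *m J p) v = - bform (g p) u (v *m J p).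
Proof. by rewrite -[in RHS]Jg mulJJ bformNr opprK. Qed.

Let om X Y := kahler_form J g X Y.

Let omE X Y p : om X Y p = bform (g p) (X p) (Y p *m J p).
Proof. by []. Qed.

Lemma smooth_kahler_form U X Y : open U -> smooth_field U X -> smooth_field U Y ->
  smooth_fun U (kahler_form J g X Y).
Proof. by move=> oU sX sY; exact: sg oU sX (sJ oU sY). Qed.

(* conn_hor and conn_ver are the components W and w of the covariant derivative
   W^L + w xi of Y^L + h xi along X^L + f xi; w does not depend on f. *)
Definition conn_hor X f Y h : vector_field N :=
  D X Y \+ (vscale (fun p => - h p) (appE J X) \+ vscale (fun p => - f p) (appE J Y)).

Definition conn_ver X Y h : N -> R := fun p => vderiv X h p - kahler_form J g X Y p.

Section Local.
Variable U : set N.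
Hypothesis oU : open U.

Lemma smooth_conn_hor X f Y h : smooth_field U X -> smooth_field U Y ->
  smooth_fun U f -> smooth_fun U h -> smooth_field U (conn_hor X f Y h).
Proof.
move=> sX sY sf sh; apply: smooth_fieldD oU (smooth_conn oU affD sX sY) _.
apply: smooth_fieldD oU _ _.
  exact: smooth_fieldZ oU (smooth_funN oU sh) (sJ oU sX).
exact: smooth_fieldZ oU (smooth_funN oU sf) (sJ oU sY).
Qed.

Lemma smooth_conn_ver X Y h : smooth_field U X -> smooth_field U Y ->
  smooth_fun U h -> smooth_fun U (conn_ver X Y h).
Proof.
move=> sX sY sh; apply: smooth_funD oU (smooth_vderiv oU sX sh) _.
exact: smooth_funN oU (smooth_kahler_form oU sX sY).
Qed.

(** The differentiated product is h k + g(Y, Z), a function pulled back from N. *)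
Lemma vderiv_lift_metric X f Y h Z k x : U x.2 -> smooth_field U Y -> smooth_field U Z ->
  smooth_fun U h -> smooth_fun U k ->
  vderiv (L X f) (app2 G (L Y h) (L Z k)) x =
  h x.2 * vderiv X k x.2 + vderiv X h x.2 * k x.2 + vderiv X (app2 g Y Z) x.2.
Proof.
move=> Ux sY sZ sh sk.
have GE : app2 G (L Y h) (L Z k) = (fun y : M => h y.2 * k y.2 + app2 g Y Z y.2).
  by apply/funext => y; exact: bform_lift.
rewrite GE.
have E1 := vderiv_cyl (fun p => h p * k p + app2 g Y Z p) (rsubmx_lift_field tau X f x).
have E2 := vderivD Ux X (smooth_funZ oU sh sk) (sg oU sY sZ).
have E3 := congr1 (fun z => z + vderiv X (app2 g Y Z) x.2) (vderivM Ux X sh sk).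
exact: etrans E1 (etrans E2 E3).
Qed.

Lemma app2_lie_bracket_lift X f Y h Z k x : U x.2 ->
  smooth_field U X -> smooth_field U Y -> smooth_fun U f -> smooth_fun U h ->
  app2 G (lie_bracket (L X f) (L Y h)) (L Z k) x =
  (vderiv X h x.2 - vderiv Y f x.2 - 2 * om X Y x.2) * k x.2 +
  app2 g (lie_bracket X Y) Z x.2.
Proof.
move=> Ux sX sY sf sh.
have E1 := congr1 (fun w => bform (G x) w (L Z k x)) (lie_bracket_lift stau oU Ux sX sY sf sh).
have E2 := bform_lift (tau x.2) (g x.2)
  (vderiv X h x.2 - vderiv Y f x.2 - 2 * ext_deriv tau X Y x.2) (k x.2)
  (lie_bracket X Y x.2) (Z x.2).
rewrite -(dtau oU sX sY Ux) in E2.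
rewrite /om -E2 (dtau oU sX sY Ux).
exact: E1.
Qed.

End Local.

(** Both sides are paired with an arbitrary vector, and Koszul's formula is used on M and on N for
    matching fields. The remainder h omega(X, Z) + f omega(Y, Z) becomes the pairing of Z with -h JX
    - f JY by skewness of J. *)
Lemma conn_lift U X f Y h x : open U -> U x.2 ->
  smooth_field U X -> smooth_field U Y -> smooth_fun U f -> smooth_fun U h ->
  DL (L X f) (L Y h) x = L (conn_hor X f Y h) (conn_ver X Y h) x.
Proof.
move=> oU Ux sX sY sf sh; set p := x.2.
apply: (lift_form_inj (t := tau p) (gP p)) => b v.
pose Z := coord_field p v; pose k : N -> R := fun=> b.
(* The field extending the test vector is smooth only on a chart domain, hence the shrinking of
   U. *)
pose V := U `&` cdom (chart_at p).
have oV : open V by exact: openI oU (open_cdom (chart_at_atlas p)).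
have Vx : V x.2 by split => //; exact: chart_at_dom.
have {}sX : smooth_field V X by apply: smooth_field_sub sX => q; case.
have {}sY : smooth_field V Y by apply: smooth_field_sub sY => q; case.
have {}sf : smooth_fun V f by apply: smooth_fun_sub sf => q; case.
have {}sh : smooth_fun V h by apply: smooth_fun_sub sh => q; case.
have sZ : smooth_field V Z.
  by apply: smooth_field_sub (smooth_coord_field p v) => q; case.
have sk : smooth_fun V k by exact: smooth_fun_cst.
have KM := koszul (open_cyl oV) tfDL (fun y => lift_formC _ (gC y.2)) mDL
  (smooth_lift_field stau oV sX sf) (smooth_lift_field stau oV sY sh)
  (smooth_lift_field stau oV sZ sk) Vx.
have KN := koszul oV tfD gC mD sX sY sZ Vx.
have V1 := vderiv_lift_metric oV X f Vx sY sZ sh sk.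
have V2 := vderiv_lift_metric oV Y h Vx sX sZ sf sk.
have V3 := vderiv_lift_metric oV Z k Vx sX sY sf sh.
have B1 := app2_lie_bracket_lift oV Z k Vx sX sY sf sh.
have B2 := app2_lie_bracket_lift oV Y h Vx sX sZ sf sk.
have B3 := app2_lie_bracket_lift oV X f Vx sY sZ sh sk.
(* Koszul on M minus Koszul on N: the derivatives of f, h, k cancel in pairs, except X(h), which
   occurs twice, and the brackets leave the omega terms. *)
have alg (A A0 v1 v2 v3 b1 b2 b3 w1 w2 w3 c1 c2 c3 xh xk yf yk zf zh oxy oxz oyz
    ff hh kk : R) :
  2 * A = v1 + v2 - v3 + b1 - b2 - b3 -> 2 * A0 = w1 + w2 - w3 + c1 - c2 - c3 ->
  v1 = hh * xk + xh * kk + w1 -> v2 = ff * yk + yf * kk + w2 ->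
  v3 = ff * zh + zf * hh + w3 ->
  b1 = (xh - yf - 2 * oxy) * kk + c1 -> b2 = (xk - zf - 2 * oxz) * hh + c2 ->
  b3 = (yk - zh - 2 * oyz) * ff + c3 ->
  A = (xh - oxy) * kk + (A0 + (hh * oxz + ff * oyz)).
  move=> eA eA0 e1 e2 e3 e4 e5 e6; rewrite {}e1 {}e2 {}e3 {}e4 {}e5 {}e6 in eA.
  have n2 : (2 : R) != 0 by rewrite pnatr_eq0.
  apply: (mulfI n2); rewrite eA !mulrDr eA0; ring.
have ZE : Z x.2 = v by exact: coord_fieldE.
have LE : L Z k x = lift_vec (tau p) b v by rewrite /lift_field ZE.
have E := alg _ _ _ _ _ _ _ _ _ _ _ _ _ _ _ _ _ _ _ _ _ _ _ _ _ _
  KM KN V1 V2 V3 B1 B2 B3.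
apply: etrans (etrans (congr1 (bform (G x) (DL (L X f) (L Y h) x)) (esym LE)) E) _.
apply: etrans (esym (bform_lift (tau p) (g p) (conn_ver X Y h p) b
  (conn_hor X f Y h p) v)).
congr (_ * _ + _).
rewrite /conn_hor /vscale /appE /= !bformDl !bformZl !bformJ !mulrNN.
by rewrite -ZE.
Qed.

(** J^2 = -1 turns the corrections -k JT - c JZ into k T + c Z, the source of the terms h k X and f
    k Y in the curvature. *)
Lemma conn_horJ (T Z : vector_field N) c k p :
  conn_hor T c Z k p *m J p = D T Z p *m J p + (k p *: T p + c p *: Z p).
Proof.
by rewrite /conn_hor /vscale /appE /= !mulmxDl -!scalemxAl !mulJJ !scalerN !scaleNr !opprK.
Qed.

(** * Curvature, Ricci tensor and scalar curvature of the lift *)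

Section Curvature.
Variables (U : set N) (X Y Z : vector_field N) (f h k : N -> R).
Hypotheses (oU : open U) (sX : smooth_field U X) (sY : smooth_field U Y)
  (sZ : smooth_field U Z) (sf : smooth_fun U f) (sh : smooth_fun U h)
  (sk : smooth_fun U k).

Let b p := vderiv X h p - vderiv Y f p - 2 * kahler_form J g X Y p.

Let sb : smooth_fun U b.
Proof.
apply: smooth_funD oU (smooth_funD oU (smooth_vderiv oU sX sh)
  (smooth_funN oU (smooth_vderiv oU sY sf))) _.
exact: smooth_funN oU (smooth_funZ oU (smooth_fun_cst U (2 : R))
  (smooth_kahler_form oU sX sY)).
Qed.

Let conn_conn_lift (S T : vector_field N) (a c : N -> R) x : U x.2 ->
  smooth_field U S -> smooth_field U T -> smooth_fun U a -> smooth_fun U c ->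
  DL (L S a) (DL (L T c) (L Z k)) x =
  L (conn_hor S a (conn_hor T c Z k) (conn_ver T Z k))
    (conn_ver S (conn_hor T c Z k) (conn_ver T Z k)) x.
Proof.
move=> Ux sS sT sa sc.
have sLS := smooth_lift_field stau oU sS sa.
have sLT := smooth_lift_field stau oU sT sc.
have sLZ := smooth_lift_field stau oU sZ sk.
(* The inner derivative is a lifted field only over U, so locality is needed before differentiating
   again. *)
have E y : cyl U y -> DL (L T c) (L Z k) y = L (conn_hor T c Z k) (conn_ver T Z k) y.
  by move=> Uy; exact: conn_lift oU Uy sT sZ sc sk.
have e1 := conn_near (open_cyl oU) affDL Ux (fun _ _ => erefl) E sLS
  (smooth_conn (open_cyl oU) affDL sLT sLZ).
apply: etrans e1 _.
exact: conn_lift oU Ux sS (smooth_conn_hor oU sT sZ sc sk) sa (smooth_conn_ver oU sT sZ sk).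
Qed.

Lemma curvature_lift x : U x.2 -> curvature DL (L X f) (L Y h) (L Z k) x =
  lift_vec (tau x.2)
    (conn_ver X (conn_hor Y h Z k) (conn_ver Y Z k) x.2
     - conn_ver Y (conn_hor X f Z k) (conn_ver X Z k) x.2
     - conn_ver (lie_bracket X Y) Z k x.2)
    (conn_hor X f (conn_hor Y h Z k) (conn_ver Y Z k) x.2
     - conn_hor Y h (conn_hor X f Z k) (conn_ver X Z k) x.2
     - conn_hor (lie_bracket X Y) b Z k x.2).
Proof.
move=> Ux; have sLX := smooth_lift_field stau oU sX sf.
have sLY := smooth_lift_field stau oU sY sh.
have sLZ := smooth_lift_field stau oU sZ sk.
have sB := smooth_lie_bracket oU affD tfD sX sY.
have EB y : cyl U y -> lie_bracket (L X f) (L Y h) y = L (lie_bracket X Y) b y.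
  move=> Uy; apply: etrans (lie_bracket_lift stau oU Uy sX sY sf sh) _.
  by rewrite /lift_field /b (dtau oU sX sY (Uy : U y.2)).
have e1 := conn_conn_lift Ux sX sY sf sh.
have e2 := conn_conn_lift Ux sY sX sh sf.
have e3 := etrans (conn_near (open_cyl oU) affDL Ux EB (fun _ _ => erefl)
  (smooth_lie_bracket (open_cyl oU) affDL tfDL sLX sLY) sLZ)
  (conn_lift oU Ux sB sZ sb sk).
have e := congr2 (fun z w => z - w) (congr2 (fun z w => z - w) e1 e2) e3.
by apply: etrans e _; rewrite !lift_vecB.
Qed.

(** Parallelism of J enters here: D_S (k JT) = S(k) JT + k J D_S T. *)
Let conn_conn_hor (S T : vector_field N) c p : U p ->
  smooth_field U S -> smooth_field U T -> smooth_fun U c ->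
  D S (conn_hor T c Z k) p = D S (D T Z) p
    + (- vderiv S k p *: (T p *m J p) + - k p *: (D S T p *m J p)
       + (- vderiv S c p *: (Z p *m J p) + - c p *: (D S Z p *m J p))).
Proof.
move=> Up sS sT sc.
have sJT := sJ oU sT; have sJZ := sJ oU sZ.
have s1 := smooth_fieldZ oU (smooth_funN oU sk) sJT.
have s2 := smooth_fieldZ oU (smooth_funN oU sc) sJZ.
have e0 := connDr oU affD sS (smooth_conn oU affD sT sZ) (smooth_fieldD oU s1 s2) Up.
have e1 := connDr oU affD sS s1 s2 Up.
have e2 := connZr oU affD (smooth_funN oU sk) sS sJT Up.
have e3 := connZr oU affD (smooth_funN oU sc) sS sJZ Up.
rewrite (vderivN Up S sk) (DJ oU sS sT Up) in e2.
rewrite (vderivN Up S sc) (DJ oU sS sZ Up) in e3.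
rewrite {}e2 {}e3 in e1; rewrite {}e1 in e0.
exact: e0.
Qed.

(** The derivatives of f, h, k cancel, and the terms in J D_X Y and J D_Y X cancel against J [X, Y]
    by torsion-freeness; the omega terms come from [conn_ver] and from the vertical part [b] of the
    bracket. *)
Lemma conn_hor_curvature p : U p ->
  conn_hor X f (conn_hor Y h Z k) (conn_ver Y Z k) p
   - conn_hor Y h (conn_hor X f Z k) (conn_ver X Z k) p
   - conn_hor (lie_bracket X Y) b Z k p =
  curvature D X Y Z p + om Y Z p *: (X p *m J p) - om X Z p *: (Y p *m J p)
  - (2 * om X Y p) *: (Z p *m J p) + (h p * k p) *: X p - (f p * k p) *: Y p.
Proof.
move=> Up.
have alg (u1 u2 u3 a1 a2 a3 xj yj zj x y z dxyj dyxj dxzj dyzj bj : 'rV[R]_m)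
    (ff hh kk xh xk yf yk oxy oxz oyz : R) :
  u1 = a1 + (- xk *: yj + - kk *: dxyj + (- xh *: zj + - hh *: dxzj))
    + (- (yk - oyz) *: xj + - ff *: (dyzj + (kk *: y + hh *: z))) ->
  u2 = a2 + (- yk *: xj + - kk *: dyxj + (- yf *: zj + - ff *: dyzj))
    + (- (xk - oxz) *: yj + - hh *: (dxzj + (kk *: x + ff *: z))) ->
  u3 = a3 + (- kk *: bj + - (xh - yf - 2 * oxy) *: zj) ->
  bj = dxyj - dyxj ->
  u1 - u2 - u3 = a1 - a2 - a3 + oyz *: xj - oxz *: yj - (2 * oxy) *: zj
    + (hh * kk) *: x - (ff * kk) *: y.
  by move=> -> -> -> ->; apply/rowP => i; rewrite !mxE; ring.
have c1 := conn_conn_hor Up sX sY sh.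
have c2 := conn_conn_hor Up sY sX sf.
have u1 : conn_hor X f (conn_hor Y h Z k) (conn_ver Y Z k) p = _ :=
  congr2 (fun s t => s + (- conn_ver Y Z k p *: (X p *m J p) + - f p *: t))
    c1 (conn_horJ Y Z h k p).
have u2 : conn_hor Y h (conn_hor X f Z k) (conn_ver X Z k) p = _ :=
  congr2 (fun s t => s + (- conn_ver X Z k p *: (Y p *m J p) + - h p *: t))
    c2 (conn_horJ X Z f k p).
have bJ : lie_bracket X Y p *m J p = D X Y p *m J p - D Y X p *m J p.
  by rewrite -mulmxBl; congr (_ *m J p); exact: esym (tfD oU sX sY Up).
exact: (alg _ _ _ _ _ _ _ _ _ _ _ _ _ _ _ _ _ _ _ _ _ _ _ _ _ _ _ u1 u2 erefl bJ).
Qed.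

End Curvature.

(** The case X = 0, f = 1, that is X^L + f xi = xi = d/dt: the one direction in which the Ricci
    trace reads the vertical component. *)
Lemma curvature_lift_reeb U Y Z h k x : open U -> U x.2 ->
  smooth_field U Y -> smooth_field U Z -> smooth_fun U h -> smooth_fun U k ->
  curvature DL (L (fun=> 0) (fun=> 1)) (L Y h) (L Z k) x =
  lift_vec (tau x.2) (app2 g Y Z x.2) (- k x.2 *: Y x.2).
Proof.
move=> oU Ux sY sZ sh sk; set p := x.2.
pose O : vector_field N := fun=> 0.
have sO : smooth_field U O by exact: smooth_field0.
have s1 : smooth_fun U (fun=> 1 : R) by exact: smooth_fun_cst.
apply: etrans (curvature_lift oU sO sY sZ s1 sh sk Ux) _.
have H := conn_hor_curvature oU sO sY sZ s1 sh sk Ux.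
have O0 q : U q -> O q = 0 by [].
rewrite {}H (curvature_vanish1 oU affD tfD Ux O0 sY sZ).
have [B0 _] := lie_bracket_vanish oU affD tfD Ux O0 sY.
have omO T q : O q = 0 -> om O T q = 0 by move=> e; rewrite omE e bform0l.
have cO T a q : conn_ver O T a q = 0.
  by rewrite /conn_ver vderiv0// -/(om O T q) omO// subr0.
(* The derivative along xi has horizontal part -JZ, which J sends back to Z; pairing with Y through
   omega then gives g(Y, Z). *)
have C2 : conn_hor O (fun=> 1) Z k p *m J p = Z p.
  rewrite conn_horJ.
  have [-> _] := conn_vanish oU affD Ux O0 sZ.
  by rewrite mul0mx scaler0 scale1r !add0r.
have cY : conn_ver Y (conn_hor O (fun=> 1) Z k) (conn_ver O Z k) p = - app2 g Y Z p.
  have -> : conn_ver O Z k = (fun=> 0) by apply/funext => q; exact: cO.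
  rewrite /conn_ver vderiv_cst sub0r -/(om Y _ p) omE C2.
  by [].
have cB : conn_ver (lie_bracket O Y) Z k p = 0.
  by rewrite /conn_ver vderiv0// -/(om _ _ p) omE B0 bform0l subr0.
have -> : conn_ver O (conn_hor Y h Z k) (conn_ver Y Z k) p = 0 by exact: cO.
rewrite cY cB sub0r opprK subr0; congr lift_vec.
rewrite !omO// mul0mx !scaler0 mulr0 !scale0r mul1r scaleNr.
by rewrite !(add0r, addr0, subr0).
Qed.

(** Skewness gives J = -g J^T g^{-1}, so the trace equals its own negative. *)
Lemma mxtrace_complex p : \tr (J p) = 0.
Proof.
have ug : g p \in unitmx by apply: posdef_unitmx; exact: gP.
have JgT : J p *m g p = - (g p *m (J p)^T).
  apply/matrixP => i j; rewrite -[LHS]bform_delta [RHS]mxE -[X in _ = - X]bform_delta.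
  have := bformJ p (delta_mx 0 i) (delta_mx 0 j).
  by rewrite /bform trmx_mul !mulmxA.
have JE : J p = - (g p *m (J p)^T *m invmx (g p)) by rewrite -mulNmx -JgT mulmxK.
have : \tr (J p) = - \tr (J p).
  by rewrite [in LHS]JE raddfN /= mxtrace_mulC mulKmx// mxtrace_tr.
by move/eqP; rewrite -addr_eq0 -mulr2n mulrn_eq0 => /eqP.
Qed.

(** Smoothness is asked on the chart domain alone, so that both global fields and coordinate fields
    qualify. *)
Lemma ricci_lift Y Z h k x : let U := cdom (chart_at x.2) in
  smooth_field U Y -> smooth_field U Z -> smooth_fun U h -> smooth_fun U k ->
  ricci DL (L Y h) (L Z k) x =
  ricci D Y Z x.2 - 2 * app2 g Y Z x.2 + m%:R * (h x.2 * k x.2).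
Proof.
move=> U sY sZ sh sk; set p := x.2.
have oU : open U by exact: open_cdom (chart_at_atlas p).
have Ux : U x.2 by exact: chart_at_dom.
have sLY := smooth_lift_field stau oU sY sh.
have sLZ := smooth_lift_field stau oU sZ sk.
have sE v : smooth_field U (coord_field p v) by exact: smooth_coord_field.
have sf v (w : 'rV[R]_(1 + m)) :
    smooth_fun U (fun q => lsubmx w 0 0 + app1 tau (coord_field p v) q).
  exact: smooth_funD oU (smooth_fun_cst _ _) (stau oU (sE v)).
have E (w : 'rV[R]_(1 + m)) : curvature DL (coord_field x w) (L Y h) (L Z k) x =
    curvature DL (L (coord_field p (rsubmx w)) (fun q => lsubmx w 0 0 +
      app1 tau (coord_field p (rsubmx w)) q)) (L Y h) (L Z k) x.
  have sL := smooth_lift_field stau oU (sE (rsubmx w)) (sf (rsubmx w) w).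
  have eX y : cyl U y -> L (coord_field p (rsubmx w)) (fun q => lsubmx w 0 0 +
      app1 tau (coord_field p (rsubmx w)) q) y = coord_field x w y.
    by move=> Uy; exact: esym (coord_field_lift tau w Uy).
  have eY y : cyl U y -> L Y h y = L Y h y by [].
  have eZ y : cyl U y -> L Z k y = L Z k y by [].
  exact: esym (curvature_near (open_cyl oU) affDL tfDL Ux eX eY eZ sL sLY sLZ).
pose c : 'rV[R]_m := Y p; pose t := (c *m tau p) 0 0.
(* Row j of K is the correction to the horizontal part of R_{e_j Y} Z; the last term of K comes from
   the xi-component tau(e_j) of e_j. *)
pose K := om Y Z p *: J p - g p *m (Z p *m J p)^T *m (Y p *m J p)
  - 2 *: (g p *m (Y p *m J p)^T *m (Z p *m J p)) + (h p * k p)%:M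
  - k p *: (tau p *m Y p).
(* The d/dt entry of the lift of -k Y is k tau(Y); it will cancel the trace of the last term of
   K. *)
have e0 : curvature DL (coord_field x (delta_mx 0 (lshift m 0))) (L Y h) (L Z k) x
    0 (lshift m 0) = app2 g Y Z p + k p * t.
  have r0 : rsubmx (delta_mx 0 (lshift m 0) : 'rV[R]_(1 + m)) = 0.
    by apply/rowP => i; rewrite !mxE eq_rlshift.
  have l1 : lsubmx (delta_mx 0 (lshift m 0) : 'rV[R]_(1 + m)) 0 0 = 1.
    by rewrite !mxE !eqxx.
  have f1 : (fun q => lsubmx (delta_mx 0 (lshift m 0) : 'rV[R]_(1 + m)) 0 0 +
      app1 tau (coord_field p 0) q) = (fun=> 1).
    by apply/funext => q; rewrite l1 coord_field0 /app1 mul0mx mxE addr0.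
  rewrite E r0 f1 coord_field0 (curvature_lift_reeb oU Ux sY sZ sh sk).
  by rewrite /lift_vec row_mxEl mxE eqxx mulr1n -scalemxAl mxE mulNr opprK.
have ej j : curvature DL (coord_field x (delta_mx 0 (rshift 1 j))) (L Y h) (L Z k) x
    0 (rshift 1 j) =
    curvature D (coord_field p (delta_mx 0 j)) Y Z p 0 j +
    ((delta_mx 0 j : 'rV_m) *m K) 0 j.
  have rj : rsubmx (delta_mx 0 (rshift 1 j) : 'rV[R]_(1 + m)) = delta_mx 0 j.
    by apply/rowP => i; rewrite !mxE eq_rshift.
  have l0 : lsubmx (delta_mx 0 (rshift 1 j) : 'rV[R]_(1 + m)) 0 0 = 0.
    by rewrite !mxE eq_lrshift.
  have F := sf (delta_mx 0 j) (delta_mx 0 (rshift 1 j)).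
  rewrite E rj (curvature_lift oU (sE (delta_mx 0 j)) sY sZ F sh sk Ux).
  rewrite /lift_vec row_mxEr (conn_hor_curvature oU (sE (delta_mx 0 j)) sY sZ F sh sk Ux).
  set e := coord_field p (delta_mx 0 j).
  have ep : e p = delta_mx 0 j by exact: coord_fieldE.
  have o1 T v : om e T p *: v = (delta_mx 0 j : 'rV_m) *m (g p *m (T p *m J p)^T *m v).
    by rewrite omE ep /bform scale_mul11 !mulmxA.
  have fE : (0 + app1 tau e p) * k p *: Y p =
      k p *: ((delta_mx 0 j : 'rV_m) *m (tau p *m Y p)).
    by rewrite add0r /app1 ep mulrC -scalerA scale_mul11 mulmxA.
  rewrite l0 fE ep -(scalerA 2) !o1.
  have addE (u v : 'rV[R]_m) : u 0 j + v 0 j = (u + v) 0 j by rewrite mxE.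
  rewrite addE /K; congr (fun_of_matrix _ 0 j).
  by rewrite mulmxBr mulmxDr !mulmxBr -!scalemxAr mul_mx_scalar !addrA.
pose F (i : 'I_(1 + m)) :=
  curvature DL (coord_field x (delta_mx 0 i)) (L Y h) (L Z k) x 0 i.
have F_split : \sum_i F i = F (lshift m 0) + \sum_j F (rshift 1 j).
  by rewrite big_split_ord big_ord1.
have sF : \sum_j F (rshift 1 j) = ricci D Y Z p + \tr K.
  apply: etrans (eq_bigr _ (fun j _ => ej j)) _.
  apply: etrans (big_split _ _ _ _ _) _.
  by rewrite sum_delta_mul (ricciE D Y Z p).
apply: etrans (ricciE DL (L Y h) (L Z k) x) _.
apply: etrans F_split _; apply: etrans (congr2 +%R e0 sF) _.
have trg T S : \tr (g p *m (T p *m J p)^T *m (S p *m J p)) = app2 g S T p.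
  by rewrite mxtrace_mul_row mulmxA; exact: Jg.
(* tr J = 0 removes the omega(Y, Z) term, and J-invariance of g turns the traces of the two rank-one
   terms into g(Y, Z). *)
have trK : \tr K = - app2 g Y Z p - 2 * app2 g Z Y p + (h p * k p) *+ m - k p * t.
  rewrite /K raddfB raddfD !raddfB /= !mxtraceZ mxtrace_complex mulr0 mxtrace_scalar.
  by rewrite !trg mxtrace_mul_row sub0r.
have gYZ : app2 g Z Y p = app2 g Y Z p by exact: bformC.
rewrite trK gYZ -mulr_natl; ring.
Qed.

(** Writing h k as the difference of the two metrics replaces eta (x) eta by g^L, whose own trace is
    the dimension; this turns 2 into 2 + m. *)
Lemma ricci_coord_lift x (w w' : 'rV[R]_(1 + m)) :
  ricci DL (coord_field x w) (coord_field x w') x =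
  ricci D (coord_field x.2 (rsubmx w)) (coord_field x.2 (rsubmx w')) x.2
  - (2 + m%:R) * bform (g x.2) (rsubmx w) (rsubmx w')
  + m%:R * bform (lift_form (tau x.2) (g x.2)) w w'.
Proof.
set p := x.2; pose U := cdom (chart_at p).
have oU : open U by exact: open_cdom (chart_at_atlas p).
have Ux : U x.2 by exact: chart_at_dom.
pose E (v : 'rV[R]_(1 + m)) := coord_field p (rsubmx v).
pose a (v : 'rV[R]_(1 + m)) q := lsubmx v 0 0 + app1 tau (E v) q.
have sE v : smooth_field U (E v) by exact: smooth_coord_field.
have sa v : smooth_fun U (a v).
  exact: smooth_funD oU (smooth_fun_cst _ _) (stau oU (sE v)).
have Ep v : E v p = rsubmx v by exact: coord_fieldE.
have ap v : v = lift_vec (tau p) (a v p) (rsubmx v).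
  by rewrite [LHS](lift_vecP (tau p)) /a /app1 Ep.
have EL v y : cyl U y -> L (E v) (a v) y = coord_field x v y.
  by move=> Uy; exact: esym (coord_field_lift tau v Uy).
have e1 := ricci_near (open_cyl oU) affDL tfDL Ux (fun _ H => H) (EL w) (EL w')
  (smooth_lift_field stau oU (sE w) (sa w)) (smooth_lift_field stau oU (sE w') (sa w')).
have e2 := ricci_lift (sE w) (sE w') (sa w) (sa w').
apply: etrans (esym e1) _; apply: etrans e2 _.
have -> : app2 g (E w) (E w') x.2 = bform (g p) (rsubmx w) (rsubmx w').
  by rewrite -!Ep.
have -> : bform (lift_form (tau p) (g p)) w w' =
    a w p * a w' p + bform (g p) (rsubmx w) (rsubmx w').
  exact: etrans (congr2 (bform _) (ap w) (ap w')) (bform_lift _ _ _ _ _ _).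
have alg (r b aa c : R) : r - 2 * b + c * aa = r - (2 + c) * b + c * (aa + b) by ring.
exact: alg.
Qed.

Lemma scalar_curvature_lift x :
  scalar_curvature G DL x = scalar_curvature g D x.2 - m%:R.
Proof.
set p := x.2; pose U := cdom (chart_at p).
have oU : open U by exact: open_cdom (chart_at_atlas p).
have Up : U p by exact: chart_at_dom.
have UU : U `<=` cdom (chart_at p) by [].
pose O : vector_field N := fun=> 0.
have O0 q : U q -> O q = 0 by [].
have sE v : smooth_field U (coord_field p v) by exact: smooth_coord_field.
(* d/dt projects to 0, so its row and column in the pulled-back Ricci matrix vanish. *)
have z1 v := ricci_vanish1 oU affD tfD Up UU O0 (sE v).
have z2 v := ricci_vanish2 oU affD tfD Up UU O0 (sE v).
pose Gx := lift_form (tau p) (g p).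
pose Ric0 := \matrix_(i, j) ricci D (coord_field p (delta_mx 0 i))
  (coord_field p (delta_mx 0 j)) p.
pose C := Ric0 - (2 + m%:R) *: g p.
have rsub_l : rsubmx (delta_mx 0 (lshift m 0) : 'rV[R]_(1 + m)) = 0.
  by apply/rowP => i; rewrite !mxE eq_rlshift.
have rsub_r j : rsubmx (delta_mx 0 (rshift 1 j) : 'rV[R]_(1 + m)) = delta_mx 0 j.
  by apply/rowP => i; rewrite !mxE eq_rshift.
have RicE : \matrix_(i, j) ricci DL (coord_field x (delta_mx 0 i))
    (coord_field x (delta_mx 0 j)) x = m%:R *: Gx + block_mx 0 0 0 C.
  apply/matrixP => i j; rewrite mxE.
  apply: etrans (ricci_coord_lift x (delta_mx 0 i) (delta_mx 0 j)) _.
  rewrite bform_delta [RHS]mxE [X in _ = X + _]mxE addrC; congr (_ + _).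
  case: (split_ordP i) => i' ->; case: (split_ordP j) => j' ->.
  - rewrite block_mxEul [RHS]mxE (ord1 i') rsub_l bform0l coord_field0 mulr0 subr0.
    exact: z1.
  - rewrite block_mxEur [RHS]mxE (ord1 i') rsub_l bform0l coord_field0 mulr0 subr0.
    exact: z1.
  - rewrite block_mxEdl [RHS]mxE (ord1 j') rsub_l bform0r coord_field0 mulr0 subr0.
    exact: z2.
  by rewrite block_mxEdr !rsub_r bform_delta /C !mxE.
have uG : Gx \in unitmx by apply: posdef_unitmx; exact: posdef_lift_form (gP p).
have ug : g p \in unitmx by apply: posdef_unitmx; exact: gP.
have E : scalar_curvature G DL x = \tr (invmx Gx *m (m%:R *: Gx + block_mx 0 0 0 C)).
  by rewrite -RicE.
(* The count is m (1 + m) + s - (2 + m) m = s - m. *)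
rewrite {}E mulmxDr mxtraceD -scalemxAr mulVmx// mxtraceZ mxtrace1.
rewrite (mxtrace_inv_lift_form (tau p) (gP p)) /C mulmxBr raddfB /= -scalemxAr mulVmx//.
rewrite mxtraceZ mxtrace1 -[\tr (invmx (g p) *m Ric0)]/(scalar_curvature g D p) natrD.
ring.
Qed.

End SasakianConnection.

Theorem proposition5 (R : realType) (n : nat) (N : smooth_manifold R (2 * n)%N)
    (J : endomorphism N) (g : two_tensor N) (tau : one_form N)
    (D : connection N) (DL : connection (line_product N)) :
  kahler J g D ->
  smooth_one_form tau ->
  (forall U, open U -> forall X Y, smooth_field U X -> smooth_field U Y ->
     forall p, U p -> kahler_form J g X Y p = ext_deriv tau X Y p) ->
  levi_civita (cm_metric (sasakian_lift J g tau)) DL ->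
  (forall X Y : vector_field N,
     smooth_field setT X -> smooth_field setT Y ->
     forall x : line_product N,
     ricci DL (horizontal_lift tau X) (horizontal_lift tau Y) x =
     ricci D X Y x.2 - 2 * app2 g X Y x.2) /\
  (forall x : line_product N,
     scalar_curvature (cm_metric (sasakian_lift J g tau)) DL x =
     scalar_curvature g D x.2 - (2 * n)%N%:R).
Proof.
move=> kJ stau dtau lcDL; split=> [X Y sX sY x|x]; last first.
  exact: scalar_curvature_lift kJ stau dtau lcDL x.
have sub Z : smooth_field setT Z -> smooth_field (cdom (chart_at x.2)) Z.
  by apply: smooth_field_sub.
have s0 := smooth_fun_cst (cdom (chart_at x.2)) (0 : R).
have := ricci_lift kJ stau dtau lcDL (sub X sX) (sub Y sY) s0 s0.
by rewrite mulr0 mulr0 addr0 !horizontal_liftE.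
Qed.
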